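(* Let $W$ be any binary memoryless symmetric (BMS) channel with capacity $C \in (0,1)$. For every sequence of Reed--Muller codes $\mathrm{RM}(r_n,m_n)$ with strictly increasing blocklength $2^{m_n}$ and rate $R(r_n,m_n)$ converging to some $R \in [0,C)$, the bit-error probability under bit-MAP decoding converges to zero, i.e. $\max_{i \in [2^{m_n}]} \Pr\big(X_i \neq \phi_i(\mathbf{Y})\big) \to 0$ as $n\to\infty$.
   Context: A BMS channel has input alphabet $\{\pm 1\}$, output alphabet the extended reals $\overline{\mathbb{R}}$, and transition density satisfying $w(y\mid +1)=w(-y\mid -1)$; it is used memorylessly (independent identically distributed uses given the inputs). Its capacity is $I(X;Y)$ for uniform input $X$. For integers $0\le r\le m$, $\mathrm{RM}(r,m)\subseteq\mathbb{F}_2^{2^m}$ is the set of vectors $(p(\tau^{-1}(0)),\dots,p(\tau^{-1}(2^m-1)))$ where $p$ ranges over $\mathbb{F}_2$-multilinear polynomials in $m$ indeterminates of total degree at most $r$ and $\tau(\mathbf{v})=\sum_{j=0}^{m-1} v_j 2^j$ for $\mathbf{v}\in\mathbb{F}_2^m$. Its rate is $R(r,m)=2^{-m}\sum_{i=0}^r\binom{m}{i}$. $[N]=\{0,\dots,N-1\}$. The transmitted vector $\mathbf{X}=(-1)^{\mathbf{u}}$ (BPSK) where $\mathbf{u}$ is a uniformly random codeword, $\mathbf{Y}$ is the channel output, and $\phi_i(\mathbf{y})=\arg\max_{x\in\{\pm1\}}\Pr(X_i=x\mid \mathbf{Y}=\mathbf{y})$ is the bit-MAP decision for code bit $i$. 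*)

(* Defs.v *)
From HB Require Import structures.
From mathcomp Require Import all_boot all_order all_algebra.
From mathcomp Require Import all_classical all_reals all_analysis measurable_realfun.

Set Implicit Arguments.
Unset Strict Implicit.
Unset Printing Implicit Defensive.

Import Order.TTheory GRing.Theory Num.Theory numFieldNormedType.Exports.
Local Open Scope classical_set_scope.
Local Open Scope ring_scope.

Section BMS.
Variable R : realType.

(* A BMS channel is given by a reference measure [mu] on the extended reals
   (the output alphabet) and the density [w y = w(y | +1)] w.r.t. [mu];
   the symmetry condition w(y | +1) = w(-y | -1) DEFINES w(. | -1).
   [mu] is required sigma-finite and invariant under y |-> -y (so that the
   density condition indeed says the law of Y given X = -1 is the reflection
   of the law of Y given X = +1). *)

Definition chan_dens (w : \bar R -> R) (x : R) (y : \bar R) : R :=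
  if x == 1 then w y else w (- y)%E.

Definition is_BMS (mu : {measure set (\bar R) -> \bar R}) (w : \bar R -> R) : Prop :=
  [/\ sigma_finite setT mu,
      (forall A : set (\bar R), measurable A ->
         mu ((fun y : \bar R => - y)%E @^-1` A) = mu A),
      (forall y, 0 <= w y),
      measurable_fun setT w &
      (\int[mu]_y (w y)%:E = 1)%E].

Definition plog2 (a b : R) : R := if a == 0 then 0 else a * (ln (a / b) / ln 2).

Definition out_dens (w : \bar R -> R) (y : \bar R) : R :=
  (chan_dens w 1 y + chan_dens w (-1) y) / 2.

(* capacity = I(X;Y) for uniform X
   = int sum_{x = +-1} 1/2 w(y|x) log2 (w(y|x) / p(y)) dmu(y) *)
Definition capacity (mu : {measure set (\bar R) -> \bar R}) (w : \bar R -> R)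
  : \bar R :=
  (\int[mu]_y ((plog2 (chan_dens w 1 y) (out_dens w y)
              + plog2 (chan_dens w (-1) y) (out_dens w y)) / 2)%:E)%E.

(* j-th coordinate of tau^{-1}(k): the j-th binary digit of k *)
Definition bit (k j : nat) : bool := odd (k %/ 2 ^ j).

(* RM(r,m): evaluations of F_2-multilinear polynomials of degree <= r,
   p = sum_{S, |S| <= r} c_S prod_{j in S} v_j  (F_2 = bool, + = addb) *)
Definition RM (r m : nat) : {set {ffun 'I_(2 ^ m) -> bool}} :=
  [set u : {ffun 'I_(2 ^ m) -> bool} | [exists c : {ffun {set 'I_m} -> bool},
     [forall S : {set 'I_m}, (r < #|S|)%N ==> ~~ c S] &&
     [forall k : 'I_(2 ^ m),
        u k == \big[addb/false]_(S : {set 'I_m})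
                  (c S && [forall j in S, bit k j])]]].

Definition rate (r m : nat) : R :=
  (\sum_(i < r.+1) 'C(m, i))%:R / (2 ^ m)%:R.

Definition bpsk (b : bool) : R := (-1) ^+ b.

(* iterated integral over (\bar R)^n w.r.t. mu^{(x) n}; outputs are lists of
   length n (for nonnegative measurable integrands this is, by Tonelli, the
   integral against the n-fold product measure) *)
Fixpoint iint (mu : {measure set (\bar R) -> \bar R}) (n : nat)
  (F : seq (\bar R) -> \bar R) : \bar R :=
  match n with
  | 0 => F [::]
  | n'.+1 => (\int[mu]_y iint mu n' (fun s => F (y :: s)))%E
  end.

Definition lik (w : \bar R -> R) (N : nat) (u : {ffun 'I_N -> bool})
  (y : seq (\bar R)) : R :=
  \prod_(j < N) chan_dens w (bpsk (u j)) (nth 0%E y j).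

Definition posterior (w : \bar R -> R) (N : nat) (C : {set {ffun 'I_N -> bool}})
  (i : 'I_N) (x : R) (y : seq (\bar R)) : R :=
  (\sum_(u in C | bpsk (u i) == x) #|C|%:R^-1 * lik w u y)
  / (\sum_(u in C) #|C|%:R^-1 * lik w u y).

Definition bitMAP (w : \bar R -> R) (N : nat) (C : {set {ffun 'I_N -> bool}})
  (i : 'I_N) (y : seq (\bar R)) : R :=
  if posterior w C i (-1) y <= posterior w C i 1 y then 1 else -1.

Definition bit_err (mu : {measure set (\bar R) -> \bar R}) (w : \bar R -> R)
  (N : nat) (C : {set {ffun 'I_N -> bool}}) (i : 'I_N) : \bar R :=
  (\sum_(u in C) (#|C|%:R^-1)%:E *
     iint mu N (fun y => ((bpsk (u i) != bitMAP w C i y)%:R * lik w u y)%:E))%E.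

End BMS.

(* Main.v *)
Require Import Defs.
From HB Require Import structures.
From mathcomp Require Import all_boot all_order all_algebra.
From mathcomp Require Import all_classical all_reals all_analysis measurable_realfun.
From mathcomp Require Import ring lra zify.
Import Order.TTheory GRing.Theory Num.Theory numFieldNormedType.Exports.

(** Quantize the channel output into a finite alphabet, softened by a little
    uniform noise so that all cells have positive probability, losing
    arbitrarily little capacity; MAP decoding of the original output is at least
    as good as any rule using the quantized one. For a linear code on a symmetric
    channel everything can be computed under the all-zero codeword, i.e. under a
    product measure [Q], where the extrinsic posterior mean [f] of a code bit
    satisfies [E f = E f^2 =: mu] (Nishimori), hence [Var f = mu (1 - mu)].

    Erase every output independently with probability [1 - t]. The mutual
    information between codeword and output ([code_info]) has as its derivative
    the sum over the code bits of the information of one more use of the channel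
    given the other outputs ([extrinsic_info]). The Plotkin extension RM(r, m+1)
    of RM(r, m) contains the copies [{(v, chi v)}] of the index set of RM(r, m),
    one for every linear form [chi]. The rates of the two codes differ by only
    [C(m, r) / 2^(m+1)], so for some [t] close to 1 their [extrinsic_info] are
    close; by a strong form of Gibbs' inequality ([separation_le]) the estimates
    [f] built from different copies are then close in [L^2(Q)]. Two copies share
    only the outputs with [chi v = 0], that is half of them, and an Efron-Stein
    argument averaged over [chi] shows [Var f -> 0]. Hence [mu] is near 0 or 1;
    the former would make [extrinsic_info] almost equal to the capacity on
    [0, t], so that the rate could not stay below capacity. *)

Set Implicit Arguments.
Unset Strict Implicit.
Unset Printing Implicit Defensive.

Local Open Scope ring_scope.

(** * Product measures on finite alphabets *)

Definition pmf (R : numDomainType) (T : finType) (p : T -> R) : Prop :=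
  (forall z, 0 <= p z) /\ \sum_z p z = 1.

Definition ffun_upd (I : finType) (T : Type) (y : {ffun I -> T}) (i : I) (z : T) :
  {ffun I -> T} := [ffun j => if j == i then z else y j].

Definition ffun_comp (I J : finType) (T : Type) (y : {ffun I -> T}) (h : J -> I) :
  {ffun J -> T} := [ffun j => y (h j)].

Section Update.
Variables (I : finType) (T : Type).
Implicit Types (y : {ffun I -> T}) (i : I) (z : T).

Lemma ffun_upd_upd y i z z' : ffun_upd (ffun_upd y i z) i z' = ffun_upd y i z'.
Proof. by apply/ffunP => j; rewrite !ffunE; case: eqP. Qed.

Lemma ffun_upd_id y i : ffun_upd y i (y i) = y.
Proof. by apply/ffunP => j; rewrite ffunE; case: eqP => // ->. Qed.

Lemma ffun_updE y i z : ffun_upd y i z i = z.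
Proof. by rewrite ffunE eqxx. Qed.

Lemma ffun_updC y i j z z' : i != j ->
  ffun_upd (ffun_upd y i z) j z' = ffun_upd (ffun_upd y j z') i z.
Proof.
move=> ij; apply/ffunP => k; rewrite !ffunE; case: (eqVneq k j) => // ->.
by rewrite eq_sym (negPf ij).
Qed.

Lemma ffun_comp_inj (h : I -> I) : injective h ->
  injective (fun y : {ffun I -> T} => ffun_comp y h).
Proof.
move=> h_inj y y' /ffunP yy'; apply/ffunP => i.
by have := yy' (invF h_inj i); rewrite !ffunE f_invF.
Qed.

End Update.

Lemma sumr_indicator (R : pzSemiRingType) (I : finType) (j : I) (F : I -> R) :
  \sum_i (i == j)%:R * F i = F j.
Proof.
by rewrite (bigD1 j) //= eqxx mul1r big1 ?addr0 // => i /negPf ->; rewrite mul0r.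
Qed.

Lemma big_pair_bool (J : finType) (S : Type) (idx : S) (op : Monoid.com_law idx)
    (F : J * bool -> S) :
  \big[op/idx]_i F i = \big[op/idx]_j op (F (j, false)) (F (j, true)).
Proof.
rewrite (eq_bigr (fun i => F (i.1, i.2))); last by case.
rewrite -(pair_bigA _ (fun j b => F (j, b))) /=.
by apply: eq_bigr => j _; rewrite big_bool Monoid.mulmC.
Qed.

Section Expectation.
Variables (R : numDomainType) (T : finType).

Definition expect (I : finType) (q : I -> T -> R) (F : {ffun I -> T} -> R) : R :=
  \sum_(y : {ffun I -> T}) (\prod_i q i (y i)) * F y.

Definition law_upd (I : finType) (q : I -> T -> R) (i : I) (p : T -> R) : I -> T -> R :=
  fun j => if j == i then p else q j.

Section OneIndexSet.
Variable I : finType.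
Implicit Types (q : I -> T -> R) (F G : {ffun I -> T} -> R) (y : {ffun I -> T}).

Lemma eq_expect q F G : F =1 G -> expect q F = expect q G.
Proof. by move=> FG; apply: eq_bigr => y _; rewrite FG. Qed.

Lemma eq_expect_law q q' F : q =2 q' -> expect q F = expect q' F.
Proof.
by move=> qq'; apply: eq_bigr => y _; congr (_ * _); apply: eq_bigr => i _.
Qed.

Lemma expectD q F G : expect q (fun y => F y + G y) = expect q F + expect q G.
Proof. by rewrite -big_split /=; apply: eq_bigr => y _; rewrite mulrDr. Qed.

Lemma expectN q F : expect q (fun y => - F y) = - expect q F.
Proof. by rewrite -sumrN; apply: eq_bigr => y _; rewrite mulrN. Qed.

Lemma expectB q F G : expect q (fun y => F y - G y) = expect q F - expect q G.
Proof. by rewrite expectD expectN. Qed.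

Lemma expectZ q F a : expect q (fun y => a * F y) = a * expect q F.
Proof. by rewrite mulr_sumr; apply: eq_bigr => y _; rewrite mulrCA. Qed.

Lemma expect_sum (A : Type) (r : seq A) (P : pred A) q (F : A -> {ffun I -> T} -> R) :
  expect q (fun y => \sum_(a <- r | P a) F a y) = \sum_(a <- r | P a) expect q (F a).
Proof.
by rewrite exchange_big /=; apply: eq_bigr => y _; rewrite mulr_sumr.
Qed.

Lemma expect_cst q a : (forall i, pmf (q i)) -> expect q (fun=> a) = a.
Proof.
move=> q_pmf; rewrite /expect -mulr_suml -(bigA_distr_bigA (fun i z => q i z)).
by rewrite big1 ?mul1r // => i _; case: (q_pmf i).
Qed.

Lemma ler_expect q F G : (forall i, pmf (q i)) -> (forall y, F y <= G y) ->
  expect q F <= expect q G.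
Proof.
move=> q_pmf FG; apply: ler_sum => y _; apply: ler_wpM2l (FG y).
by apply: prodr_ge0 => i _; case: (q_pmf i).
Qed.

Lemma expect_ge0 q F : (forall i, pmf (q i)) -> (forall y, 0 <= F y) -> 0 <= expect q F.
Proof.
by move=> q_pmf F0; rewrite -(expect_cst 0 q_pmf); exact: ler_expect.
Qed.

Lemma expect_law_updE q i p F : expect (law_upd q i p) F =
  \sum_(y : {ffun I -> T}) p (y i) * (\prod_(j | j != i) q j (y j)) * F y.
Proof.
apply: eq_bigr => y _; rewrite (bigD1 i) //= /law_upd eqxx; congr (_ * _ * _).
by apply: eq_bigr => j /negPf ->.
Qed.

Lemma expect_law_upd q i p F : \sum_z q i z = 1 ->
  expect (law_upd q i p) F = expect q (fun y => \sum_z p z * F (ffun_upd y i z)).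
Proof.
move=> q_sum1; rewrite /expect; under [RHS]eq_bigr do rewrite mulr_sumr.
rewrite pair_big /=.
pose exchange (x : {ffun I -> T} * T) := (ffun_upd x.1 i x.2, x.1 i).
have exchangeK : involutive exchange.
  by case=> y z; rewrite /exchange /= ffun_upd_upd ffun_updE ffun_upd_id.
rewrite (reindex_inj (inv_inj exchangeK)) /=.
rewrite -(pair_big xpredT xpredT (fun y z => \prod_j q j (ffun_upd y i z j) *
  (p (y i) * F (ffun_upd (ffun_upd y i z) i (y i))))) /=.
rewrite -/(expect _ _) expect_law_updE; apply: eq_bigr => y _.
under [RHS]eq_bigr => z _.
  rewrite ffun_upd_upd ffun_upd_id (bigD1 i) //= ffun_updE.
  under eq_bigr => j /negPf ji do rewrite ffunE ji.
  rewrite -mulrA.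
  over.
by rewrite -mulr_suml q_sum1 mul1r mulrCA mulrA.
Qed.

Lemma expect_resample q i F : \sum_z q i z = 1 ->
  expect q F = expect q (fun y => \sum_z q i z * F (ffun_upd y i z)).
Proof.
move=> q_sum1; rewrite -expect_law_upd //; apply: eq_expect_law => j z.
by rewrite /law_upd; case: eqP => // ->.
Qed.

Lemma expect_resample_eq0 q i F : \sum_z q i z = 1 ->
  (forall y, \sum_z q i z * F (ffun_upd y i z) = 0) -> expect q F = 0.
Proof.
move=> q_sum1 F0; rewrite (expect_resample _ q_sum1).
by apply: big1 => y _; rewrite F0 mulr0.
Qed.

Lemma expect_law_updB q i p p' F :
  expect (law_upd q i (fun z => p z - p' z)) F =
  expect (law_upd q i p) F - expect (law_upd q i p') F.
Proof.
by rewrite !expect_law_updE -sumrB; apply: eq_bigr => y _; rewrite -mulrBl -mulrBl.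
Qed.

Lemma expect_law_upd0 q i F : expect (law_upd q i (fun=> 0)) F = 0.
Proof. by rewrite expect_law_updE; apply: big1 => y _; rewrite !mul0r. Qed.

Definition free_of (i : I) F : Prop := forall y z, F (ffun_upd y i z) = F y.

Lemma expect_law_upd_free q i p F : \sum_z q i z = 1 -> \sum_z p z = 1 ->
  free_of i F -> expect (law_upd q i p) F = expect q F.
Proof.
move=> q_sum1 p_sum1 iF; rewrite expect_law_upd //; apply: eq_expect => y.
by under eq_bigr do rewrite iF; rewrite -mulr_suml p_sum1 mul1r.
Qed.

Lemma free_of_all_eq F : (forall i, free_of i F) -> forall y y', F y = F y'.
Proof.
move=> free_F y y'.
have upd_seq (r : seq I) : F [ffun i => if i \in r then y i else y' i] = F y'.
  elim: r => [|i r IHr]; first by congr F; apply/ffunP => i; rewrite ffunE.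
  rewrite -IHr -[RHS](free_F i _ (y i)); congr F; apply/ffunP => j.
  by rewrite !ffunE inE; case: eqP => // ->.
rewrite -(upd_seq (enum I)); congr F; apply/ffunP => i.
by rewrite ffunE mem_enum.
Qed.

Lemma free_of_all_expect q F : (forall i, pmf (q i)) -> (forall i, free_of i F) ->
  forall y, F y = expect q F.
Proof.
move=> q_pmf free_F y; rewrite -[LHS](expect_cst _ q_pmf).
by apply: eq_expect => y'; exact: free_of_all_eq.
Qed.

Lemma expect_dirac q i e F G : (forall z, z != e -> q i z = 0) ->
  (forall y, y i = e -> F y = G y) -> expect q F = expect q G.
Proof.
move=> q_dirac FG; apply: eq_bigr => y _; case: (eqVneq (y i) e) => [/FG -> //|ye].
by rewrite (bigD1 i) //= q_dirac // !mul0r.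
Qed.

Lemma expect_comp q (h : I -> I) F : injective h ->
  expect q (fun y => F (ffun_comp y h)) = expect (fun i => q (h i)) F.
Proof.
move=> h_inj; rewrite /expect [RHS](reindex_inj (ffun_comp_inj h_inj)) /=.
apply: eq_bigr => y _; congr (_ * _).
by rewrite (reindex_inj h_inj) /=; apply: eq_bigr => i _; rewrite ffunE.
Qed.

End OneIndexSet.

Lemma expect_pair_bool (J : finType) (q : J * bool -> T -> R)
    (F : {ffun J -> T} -> {ffun J -> T} -> R) :
  expect q (fun y => F (ffun_comp y (pair^~ false)) (ffun_comp y (pair^~ true)))
  = expect (fun j => q (j, false)) (fun y0 => expect (fun j => q (j, true)) (F y0)).
Proof.
rewrite /expect; under [RHS]eq_bigr do rewrite mulr_sumr.
rewrite pair_big /=.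
pose merge (x : {ffun J -> T} * {ffun J -> T}) : {ffun J * bool -> T} :=
  [ffun i => if i.2 then x.2 i.1 else x.1 i.1].
pose halves (y : {ffun J * bool -> T}) :=
  (ffun_comp y (pair^~ false), ffun_comp y (pair^~ true)).
have mergeK : cancel merge halves.
  by case=> y0 y1; rewrite /halves; congr pair; apply/ffunP => j; rewrite !ffunE.
have halvesK : cancel halves merge.
  by move=> y; apply/ffunP => -[j []]; rewrite !ffunE.
rewrite (reindex merge) /=; last by exists halves => x _.
apply: eq_bigr => -[y0 y1] _ /=.
have /= := mergeK (y0, y1); rewrite /halves => -[-> ->].
rewrite mulrA big_pair_bool /= big_split /=.
by congr (_ * _ * _); apply: eq_bigr => j _; rewrite ffunE.
Qed.

End Expectation.

(** * Sharing a random set of coordinates *)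

Section Splicing.
Variables (R : realFieldType) (T J : finType) (q : J -> T -> R).
Hypothesis q_pmf : forall i, pmf (q i).
Implicit Types (B : {set J}) (F G : {ffun J -> T} -> R) (y : {ffun J -> T}) (i : J).

Let q_sum1 i : \sum_z q i z = 1. Proof. by case: (q_pmf i). Qed.

Definition splice B y y' : {ffun J -> T} := [ffun i => if i \in B then y i else y' i].

Definition splice_corr B F G : R :=
  expect q (fun y => expect q (fun y' => F y * G (splice B y y'))).

Lemma splice_updl B y y' i z : splice B (ffun_upd y i z) y' =
  if i \in B then ffun_upd (splice B y y') i z else splice B y y'.
Proof.
by apply/ffunP => j; case: ifP => iB; rewrite !ffunE; case: (eqVneq j i) => // ->; rewrite iB.
Qed.

Lemma splice_updr B y y' i z : splice B y (ffun_upd y' i z) =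
  if i \in B then splice B y y' else ffun_upd (splice B y y') i z.
Proof.
by apply/ffunP => j; case: ifP => iB; rewrite !ffunE; case: (eqVneq j i) => // ->; rewrite iB.
Qed.

Lemma expect_splice B F :
  expect q (fun y => expect q (fun y' => F (splice B y y'))) = expect q F.
Proof.
pose exchange (x : {ffun J -> T} * {ffun J -> T}) := (splice B x.1 x.2, splice B x.2 x.1).
have exchangeK : involutive exchange.
  by case=> y y'; congr pair; apply/ffunP => i; rewrite !ffunE; case: (i \in B).
rewrite {1}/expect; under eq_bigr do rewrite mulr_sumr.
rewrite pair_big /= (reindex_inj (inv_inj exchangeK)) /=.
rewrite (eq_bigr (fun x : {ffun J -> T} * {ffun J -> T} =>
  (\prod_i q i (x.1 i)) * ((\prod_i q i (x.2 i)) * F x.1))).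
  rewrite -(pair_bigA _ (fun y y' : {ffun J -> T} =>
    (\prod_i q i (y i)) * ((\prod_i q i (y' i)) * F y))) /=.
  by apply: eq_bigr => y _; rewrite -mulr_sumr -[X in _ * X]/(expect q _) expect_cst.
case=> y y' _ /=; rewrite !mulrA -!big_split /=; congr (_ * _); last first.
  by congr F; apply/ffunP => i; rewrite !ffunE; case: (i \in B).
by apply: eq_bigr => i _; rewrite !ffunE; case: ifP => // _; rewrite mulrC.
Qed.

Lemma splice_corrDl B F G H :
  splice_corr B (fun y => F y + G y) H = splice_corr B F H + splice_corr B G H.
Proof.
rewrite /splice_corr -expectD; apply: eq_expect => y; rewrite -expectD.
by apply: eq_expect => y'; rewrite mulrDl.
Qed.

Lemma splice_corrDr B F G H :
  splice_corr B H (fun y => F y + G y) = splice_corr B H F + splice_corr B H G.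
Proof.
rewrite /splice_corr -expectD; apply: eq_expect => y; rewrite -expectD.
by apply: eq_expect => y'; rewrite mulrDr.
Qed.

Lemma splice_corr_le B F : splice_corr B F F <= expect q (fun y => F y ^+ 2).
Proof.
have -> : expect q (fun y => F y ^+ 2) =
    expect q (fun y => expect q (fun y' => 2^-1 * (F y ^+ 2 + F (splice B y y') ^+ 2))).
  under [RHS]eq_expect do rewrite expectZ expectD expect_cst //.
  by rewrite expectZ expectD (expect_splice B (fun y => F y ^+ 2)); field.
apply: ler_expect => // y; apply: ler_expect => // y'.
have := sqr_ge0 (F y - F (splice B y y')); nra.
Qed.

Lemma splice_corr_cst B F : (forall i, free_of i F) -> splice_corr B F F = expect q F ^+ 2.
Proof.
move=> free_F; rewrite -[RHS](expect_cst _ q_pmf); apply: eq_expect => y.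
rewrite -[RHS](expect_cst _ q_pmf); apply: eq_expect => y'.
by rewrite !(free_of_all_expect q_pmf free_F) -?expr2.
Qed.

Section AverageOut.
Variables (i : J) (F : {ffun J -> T} -> R).

Definition average_out y : R := \sum_z q i z * F (ffun_upd y i z).

Let rem y := F y - average_out y.

Lemma free_of_average_out : free_of i average_out.
Proof. by move=> y z; apply: eq_bigr => z' _; rewrite ffun_upd_upd. Qed.

Lemma average_out_free_of j : free_of j F -> free_of j average_out.
Proof.
have [-> _|ji jF y z] := eqVneq j i; first exact: free_of_average_out.
by apply: eq_bigr => z' _; rewrite ffun_updC // jF.
Qed.

Lemma average_out_id : free_of i F -> average_out =1 F.
Proof.
move=> iF y; rewrite /average_out; under eq_bigr do rewrite iF.
by rewrite -mulr_suml q_sum1 mul1r.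
Qed.

Lemma expect_average_out : expect q average_out = expect q F.
Proof. by rewrite -expect_resample. Qed.

Let average_rem0 y : \sum_z q i z * rem (ffun_upd y i z) = 0.
Proof.
under eq_bigr do rewrite /rem free_of_average_out mulrBr.
by rewrite sumrB -mulr_suml q_sum1 mul1r subrr.
Qed.

Lemma expect_sqr_average_out : expect q (fun y => F y ^+ 2) =
  expect q (fun y => average_out y ^+ 2) + expect q (fun y => rem y ^+ 2).
Proof.
have orthogonal : expect q (fun y => average_out y * rem y) = 0.
  apply: (expect_resample_eq0 (q_sum1 i)) => y.
  under eq_bigr do rewrite free_of_average_out mulrCA.
  by rewrite -mulr_sumr average_rem0 mulr0.
rewrite -[RHS]addr0 -(mulr0 2) -{}orthogonal -expectZ -!expectD.
by apply: eq_expect => y; rewrite /rem; ring.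
Qed.

Let expect_resample_inner_eq0 (F2 : {ffun J -> T} -> {ffun J -> T} -> R) :
  (forall y y', \sum_z q i z * F2 (ffun_upd y i z) y' = 0) ->
  expect q (fun y => expect q (F2 y)) = 0.
Proof.
move=> F2_0; apply: (expect_resample_eq0 (q_sum1 i)) => y.
under eq_bigr do rewrite -expectZ.
by rewrite -expect_sum; apply: big1 => y' _; rewrite F2_0 mulr0.
Qed.

Lemma splice_corr_average_rem B : splice_corr B average_out rem = 0.
Proof.
case iB: (i \in B).
  apply: expect_resample_inner_eq0 => y y'.
  under eq_bigr do rewrite free_of_average_out splice_updl iB mulrCA.
  by rewrite -mulr_sumr average_rem0 mulr0.
apply: big1 => y _; rewrite (expect_resample_eq0 (q_sum1 i)) ?mulr0 // => y'.
under eq_bigr do rewrite splice_updr iB mulrCA.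
by rewrite -mulr_sumr average_rem0 !mulr0.
Qed.

Lemma splice_corr_rem_average B : splice_corr B rem average_out = 0.
Proof.
apply: expect_resample_inner_eq0 => y y'.
under eq_bigr do rewrite splice_updl fun_if free_of_average_out if_same mulrA.
by rewrite -mulr_suml average_rem0 mul0r.
Qed.

Lemma splice_corr_rem_rem B : i \notin B -> splice_corr B rem rem = 0.
Proof.
move=> /negPf iB; apply: expect_resample_inner_eq0 => y y'.
under eq_bigr do rewrite splice_updl iB mulrA.
by rewrite -mulr_suml average_rem0 mul0r.
Qed.

Lemma splice_corr_average_out B : splice_corr B F F <=
  splice_corr B average_out average_out + (i \in B)%:R * expect q (fun y => rem y ^+ 2).
Proof.
have -> : splice_corr B F F =
    splice_corr B (fun y => average_out y + rem y) (fun y => average_out y + rem y).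
  by apply: eq_expect => y; apply: eq_expect => y'; rewrite /rem ![_ + (_ - _)]addrC !subrK.
rewrite (splice_corrDl B average_out rem) !(splice_corrDr B average_out rem).
rewrite splice_corr_average_rem splice_corr_rem_average.
rewrite addr0 add0r lerD2l; case: (boolP (i \in B)) => iB.
  by rewrite mul1r splice_corr_le.
by rewrite splice_corr_rem_rem ?mul0r.
Qed.

End AverageOut.

(* The weights come from removing one coordinate at a time: [F] splits
   orthogonally into its average over [i] and a remainder, and only the sets
   containing [i] see the remainder. *)
Lemma efron_stein_seq (r : seq J) F : exists (G : {ffun J -> T} -> R) (v : J -> R),
  [/\ forall i, i \in r -> free_of i G,
      (forall i, free_of i F -> free_of i G /\ v i = 0) /\ (forall i, 0 <= v i),
      expect q G = expect q F,
      expect q (fun y => F y ^+ 2) = expect q (fun y => G y ^+ 2) + \sum_i v i &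
      forall B, splice_corr B F F <= splice_corr B G G + \sum_(i in B) v i].
Proof.
elim: r => [|j r [G [v [rG [freeF v_ge0] meanG sqrG corrG]]]].
  exists F, (fun=> 0); split => // [|B]; last by rewrite big1 ?addr0.
  by rewrite big1 ?addr0.
pose w := expect q (fun y => (G y - average_out j G y) ^+ 2).
exists (average_out j G), (fun i => v i + (i == j)%:R * w); split.
- move=> i; rewrite inE => /predU1P[->|/rG]; first exact: free_of_average_out.
  exact: average_out_free_of.
- split=> i; last first.
    by rewrite addr_ge0 // mulr_ge0 // expect_ge0 // => y; exact: sqr_ge0.
  move=> /freeF[iG ->]; split; first exact: average_out_free_of.
  case: eqP => [ij|_]; rewrite add0r ?mul0r // mul1r.
  rewrite -[RHS](expect_cst _ q_pmf); apply: eq_expect => y.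
  by rewrite average_out_id -?ij // subrr expr0n.
- by rewrite expect_average_out.
- rewrite sqrG (expect_sqr_average_out j) -/w -addrA; congr (_ + _).
  by rewrite big_split /= (sumr_indicator j (fun=> w)) addrC.
- move=> B; apply: le_trans (corrG B) _.
  have -> : \sum_(i in B) (v i + (i == j)%:R * w) = \sum_(i in B) v i + (j \in B)%:R * w.
    rewrite big_split /= [X in _ + X]big_mkcond /=; congr (_ + _).
    rewrite -[RHS](sumr_indicator j (fun i => (i \in B)%:R * w)); apply: eq_bigr => i _.
    by case: (i \in B); rewrite ?mul1r // mul0r mulr0.
  by rewrite addrCA [leRHS]addrC lerD2r; exact: splice_corr_average_out.
Qed.

Lemma efron_stein F : exists v : J -> R,
  [/\ forall i, 0 <= v i, forall i, free_of i F -> v i = 0,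
      expect q (fun y => F y ^+ 2) = expect q F ^+ 2 + \sum_i v i &
      forall B, splice_corr B F F <= expect q F ^+ 2 + \sum_(i in B) v i].
Proof.
have [G [v [enumG [freeF v_ge0] meanG sqrG corrG]]] := efron_stein_seq (enum J) F.
have freeG i : free_of i G by apply: enumG; rewrite mem_enum.
exists v; split=> // [i /freeF[]//||B].
  rewrite sqrG -meanG; congr (_ + _); rewrite -[RHS](expect_cst _ q_pmf).
  by apply: eq_expect => y; rewrite (free_of_all_expect q_pmf freeG).
by rewrite -meanG -(splice_corr_cst B freeG).
Qed.

Lemma sum_splice_corr_le (A : finType) (B : A -> {set J}) (d : R) F :
  (forall i, free_of i F \/ #|[set a | i \in B a]|%:R <= d * #|A|%:R) ->
  \sum_a splice_corr (B a) F F <=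
  #|A|%:R * (expect q F ^+ 2 + d * (expect q (fun y => F y ^+ 2) - expect q F ^+ 2)).
Proof.
move=> B_density; have [v [v_ge0 v_free -> corr_le]] := efron_stein F.
apply: le_trans (ler_sum _ (fun a _ => corr_le (B a))) _.
rewrite big_split /= sumr_const -[_ ^+ 2 *+ _]mulr_natl mulrDr lerD2l.
rewrite [_ + \sum_i _]addrC addrK mulrA mulr_sumr.
under eq_bigr do rewrite big_mkcond /=.
rewrite exchange_big /=; apply: ler_sum => i _; rewrite -big_mkcond /= sumr_const.
case: (B_density i) => [/v_free ->|iB]; first by rewrite mul0rn mulr0.
by rewrite -[v i *+ _]mulr_natl ler_wpM2r // mulrC -cardsE.
Qed.

End Splicing.

(** * Derivatives and logarithms *)

Section Calculus.
Variable R : realType.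

Lemma is_derive_MVT (f df : R -> R) (a b : R) : a < b ->
  (forall x : R, is_derive x 1 f (df x)) ->
  exists c, [/\ a < c, c < b & f b - f a = df c * (b - a)].
Proof.
move=> ab f_df; have [|c] := MVT ab (fun x _ => f_df x).
  by apply: derivable_within_continuous => x _; case: (f_df x).
by rewrite in_itv /= => /andP[ac cb] fE; exists c.
Qed.

Lemma is_derive_bigsum (A : Type) (r : seq A) (f : A -> R -> R) (df : A -> R) (t : R) :
  (forall a, is_derive t 1 (f a) (df a)) ->
  is_derive t 1 (fun t => \sum_(a <- r) f a t) (\sum_(a <- r) df a).
Proof.
move=> f_df; elim: r => [|a r IHr].
  rewrite big_nil (_ : (fun _ => _) = cst 0); first exact: is_derive_cst.
  by apply/funext => x; rewrite big_nil.
rewrite big_cons (_ : (fun _ => _) = f a + (fun t => \sum_(a <- r) f a t)).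
  exact: is_deriveD.
by apply/funext => x; rewrite big_cons.
Qed.

Lemma is_derive_bigprod (A : eqType) (r : seq A) (f : A -> R -> R) (df : A -> R) (t : R) :
  uniq r -> (forall a, is_derive t 1 (f a) (df a)) ->
  is_derive t 1 (fun t => \prod_(a <- r) f a t)
    (\sum_(a <- r) \prod_(b <- r) (if b == a then df a else f b t)).
Proof.
move=> + f_df; elim: r => [_|a r IHr /= /andP[ar /IHr {}IHr]].
  rewrite big_nil (_ : (fun _ => _) = cst 1); first exact: is_derive_cst.
  by apply/funext => x; rewrite big_nil.
rewrite (_ : (fun _ => _) = f a * (fun t => \prod_(a <- r) f a t)); last first.
  by apply/funext => x; rewrite big_cons.
apply: (is_derive_eq (is_deriveM (f_df a) IHr)); rewrite -![_ *: _]/(_ * _).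
rewrite big_cons addrC /= big_cons eqxx; congr (_ + _).
  rewrite mulrC; congr (_ * _); apply: eq_big_seq => b br.
  by case: eqP => // ba; rewrite -ba br in ar.
rewrite mulr_sumr; apply: eq_big_seq => b br; rewrite big_cons.
by case: eqP => // ba; rewrite ba br in ar.
Qed.

Lemma is_derive_expect (I T : finType) (q : R -> I -> T -> R) (dq : I -> T -> R)
    (F : {ffun I -> T} -> R) (t : R) :
  (forall i z, is_derive t 1 (fun s => q s i z) (dq i z)) ->
  is_derive t 1 (fun s => expect (q s) F) (\sum_i expect (law_upd (q t) i (dq i)) F).
Proof.
move=> q_dq.
have dprod (y : {ffun I -> T}) :=
  is_derive_bigprod (index_enum_uniq I) (fun i => q_dq i (y i)).
apply: (is_derive_eq (is_derive_bigsum (index_enum {ffun I -> T})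
  (fun y => is_deriveM (dprod y) (is_derive_cst (F y) t 1)))).
under eq_bigr => y _ do rewrite scaler0 add0r -[_ *: _]/(_ * _) mulrC mulr_suml.
rewrite exchange_big; apply: eq_bigr => i _; apply: eq_bigr => y _; congr (_ * _).
by apply: eq_bigr => j _; rewrite /law_upd; case: eqP => // ->.
Qed.

Lemma ln_le_subr1 (x : R) : 0 < x -> ln x <= x - 1.
Proof. by move=> x0; rewrite -[in ln x](subrKC 1 x) le_ln1Dx //; lra. Qed.

(* [ln t = 2 ln (sqrt t)] turns [ln t <= t - 1] into a Hellinger-type bound. *)
Lemma relative_entropy_ge (a b M : R) : 0 < a -> 0 < b -> a <= M -> b <= M ->
  (a - b) ^+ 2 / (4 * M) <= a * ln (a / b) - a + b.
Proof.
move=> a0 b0 aM bM.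
pose x := Num.sqrt a; pose y := Num.sqrt b.
have x0 : 0 < x by rewrite sqrtr_gt0.
have y0 : 0 < y by rewrite sqrtr_gt0.
have aE : a = x ^+ 2 by rewrite sqr_sqrtr // ltW.
have bE : b = y ^+ 2 by rewrite sqr_sqrtr // ltW.
have hellinger : (x - y) ^+ 2 <= a * ln (a / b) - a + b.
  have -> : ln (a / b) = - (2 * ln (y / x)).
    rewrite aE bE -expr_div_n lnXn ?divr_gt0 // -[x / y]invf_div lnV ?posrE ?divr_gt0 //.
    by rewrite mulr2n; ring.
  have := ler_wpM2l (ltW a0) (ln_le_subr1 (divr_gt0 y0 x0)).
  have -> : a * (y / x - 1) = x * y - a by rewrite aE; field; rewrite lt0r_neq0.
  by rewrite bE sqrrB -aE; lra.
apply: le_trans hellinger.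
have M0 : 0 < M by exact: lt_le_trans aM.
rewrite ler_pdivrMr ?mulr_gt0 //.
have -> : (a - b) ^+ 2 = (x - y) ^+ 2 * (x + y) ^+ 2 by rewrite aE bE; ring.
rewrite ler_wpM2l ?sqr_ge0 //.
by have := sqr_ge0 (x - y); rewrite aE in aM; rewrite bE in bM; nra.
Qed.

Lemma ln2_gt0 : 0 < ln 2 :> R.
Proof. by rewrite ln_gt0 // ltr1n. Qed.

Lemma mul_ln_ratio_ge (a p : R) : 0 <= a -> 0 < p -> a - p <= a * ln (a / p).
Proof.
rewrite le_eqVlt => /predU1P[<-|a0] p0; first by rewrite mul0r sub0r oppr_le0 ltW.
have := ler_wpM2l (ltW a0) (ln_le_subr1 (divr_gt0 p0 a0)).
rewrite -[p / a]invf_div lnV ?posrE ?divr_gt0 // invf_div mulrBr mulrN mulr1 mulrCA divff.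
  by lra.
exact: lt0r_neq0.
Qed.

Lemma mul_ln_ratio_le (a p r : R) : 0 <= a -> 0 < p -> 0 < r ->
  a * ln (a / p) <= a * ln r + a * (a / (p * r) - 1).
Proof.
rewrite le_eqVlt => /predU1P[<-|a0] p0 r0; first by rewrite !mul0r addr0.
rewrite -mulrDr ler_wpM2l ?(ltW a0) // -lerBlDl -ln_div ?posrE ?divr_gt0 //.
have -> : a / (p * r) = a / p / r by rewrite invfM mulrA.
by apply: ln_le_subr1; rewrite !divr_gt0.
Qed.

(* Relative entropy is at most chi-square distance; this bounds the loss caused by
   replacing the bias [(a - b) / (a + b)] of the input bit by [r]. *)
Lemma binary_divergence_le_chi2 (a b r : R) : 0 <= a -> 0 <= b -> -1 < r < 1 ->
  a * ln (a / ((a + b) / 2)) + b * ln (b / ((a + b) / 2)) <=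
  a * ln (1 + r) + b * ln (1 - r) + (a + b) * (((a - b) / (a + b) - r) ^+ 2 / (1 - r ^+ 2)).
Proof.
move=> a0 b0 /andP[r1 r2]; have := addr_ge0 a0 b0; rewrite le_eqVlt => /predU1P[ab0|ab].
  have -> : a = 0 by lra.
  have -> : b = 0 by lra.
  by rewrite addr0 !mul0r !addr0.
have p0 : 0 < (a + b) / 2 by rewrite divr_gt0.
have ra : 0 < 1 + r by lra.
have rb : 0 < 1 - r by lra.
apply: le_trans (lerD (mul_ln_ratio_le a0 p0 ra) (mul_ln_ratio_le b0 p0 rb)) _.
rewrite [leLHS](_ : _ = a * ln (1 + r) + b * ln (1 - r) +
  (a + b) * (((a - b) / (a + b) - r) ^+ 2 / (1 - r ^+ 2))) //.
have r2n : 1 - r ^+ 2 != 0 by rewrite -(expr1n _ 2) subr_sqr mulf_neq0 // lt0r_neq0.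
by field; rewrite r2n !lt0r_neq0.
Qed.

End Calculus.

(** * Linear codes on finite symmetric channels *)

(* [law] is the output law of the input bit 0; that of the input bit 1 is
   [law \o mirror]. The erasure symbol tells nothing about the input. *)
Record symmetric_channel (R : realType) := SymmetricChannel {
  output :> finType;
  mirror : output -> output;
  erasure : output;
  law : output -> R;
  mirrorK : involutive mirror;
  mirror_erasure : mirror erasure = erasure;
  law_gt0 : forall z, 0 < law z;
  law_sum1 : \sum_z law z = 1
}.

Section SymmetricChannel.
Variables (R : realType) (W : symmetric_channel R).
Implicit Types (z : W) (x : R).

Definition lratio z : R := law (mirror z) / law z.

Lemma lratio_gt0 z : 0 < lratio z.
Proof. by rewrite divr_gt0 ?law_gt0. Qed.

Lemma lratio_mirror z : lratio (mirror z) = (lratio z)^-1.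
Proof. by rewrite /lratio mirrorK invf_div. Qed.

Lemma lratio_erasure : lratio (erasure W) = 1.
Proof. by rewrite /lratio mirror_erasure divff // lt0r_neq0 // law_gt0. Qed.

Definition symmetric_law (p : W -> R) : Prop :=
  pmf p /\ forall z, p (mirror z) = p z * lratio z.

Lemma law_symmetric : symmetric_law (@law R W).
Proof.
split; first by split=> [z|]; [exact/ltW/law_gt0 | exact: law_sum1].
by move=> z; rewrite /lratio mulrCA divff ?mulr1 // lt0r_neq0 // law_gt0.
Qed.

Lemma sum_mirror (F : W -> R) : \sum_z F (mirror z) = \sum_z F z.
Proof. by rewrite -(reindex_inj (inv_inj (@mirrorK R W)) (F := F) (P := xpredT)). Qed.

(* The likelihood ratio of an input bit of mean [x] and the input bit 0. *)
Definition mixture_lr z x : R := ((1 + x) + (1 - x) * lratio z) / 2.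

(* The divergence of [law] from the output law of an input bit of mean [x]; at
   [x = 0] this is the capacity in nats. *)
Definition mixture_div x : R := - \sum_z law z * ln (mixture_lr z x).

Definition separation : R := \sum_z law z * ((1 - lratio z) ^+ 2 / (16 * (1 + lratio z))).

Lemma sum_law_lratio : \sum_z law z * lratio z = 1.
Proof. by rewrite -(law_sum1 W) -sum_mirror; apply: eq_bigr => z _; case: law_symmetric. Qed.

Lemma mixture_lr_gt0 z x : `|x| <= 1 -> 0 < mixture_lr z x.
Proof.
rewrite ler_norml => /andP[x1 x2]; rewrite divr_gt0 //; have := lratio_gt0 z => l0.
have [x0|x0] := lerP 0 x; first by apply: ltr_wpDr; [apply: mulr_ge0; lra | lra].
by apply: ltr_wpDl; [lra | apply: mulr_gt0; lra].
Qed.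

Lemma mixture_lr_le z x : `|x| <= 1 -> mixture_lr z x <= 1 + lratio z.
Proof.
by rewrite ler_norml => /andP[x1 x2]; rewrite ler_pdivrMr //; have := lratio_gt0 z; nra.
Qed.

Lemma mixture_lrN z x : mixture_lr z (- x) = lratio z * mixture_lr (mirror z) x.
Proof.
by rewrite /mixture_lr lratio_mirror opprK; field; rewrite lt0r_neq0 // lratio_gt0.
Qed.

Lemma sum_law_mixture_lr x : \sum_z law z * mixture_lr z x = 1.
Proof.
under eq_bigr do rewrite /mixture_lr mulrA mulrDr (mulrCA (law _)).
by rewrite -mulr_suml big_split /= -mulr_suml -mulr_sumr sum_law_lratio law_sum1; field.
Qed.

Lemma mixture_divB x y : `|x| <= 1 -> `|y| <= 1 ->
  mixture_div y - mixture_div x = \sum_z law z * ln (mixture_lr z x / mixture_lr z y).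
Proof.
move=> x1 y1; rewrite opprK addrC -sumrB; apply: eq_bigr => z _.
by rewrite -mulrBr ln_div // posrE mixture_lr_gt0.
Qed.

Lemma sum_law_mixture_lr_lnN x y :
  \sum_z law z * ln (mixture_lr z (- x) / mixture_lr z (- y)) =
  \sum_z law z * (lratio z * ln (mixture_lr z x / mixture_lr z y)).
Proof.
rewrite -sum_mirror; apply: eq_bigr => z _; have [_ ->] := law_symmetric.
rewrite -mulrA !mixture_lrN mirrorK lratio_mirror -mulf_div mulfV ?mul1r //.
by rewrite invr_neq0 // lt0r_neq0 // lratio_gt0.
Qed.

Let separation_term_ge0 z : 0 <= law z * ((1 - lratio z) ^+ 2 / (16 * (1 + lratio z))).
Proof.
rewrite mulr_ge0 ?(ltW (law_gt0 z)) // divr_ge0 ?sqr_ge0 //.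
by rewrite mulr_ge0 // addr_ge0 // ltW // lratio_gt0.
Qed.

Lemma separation_ge0 : 0 <= separation.
Proof. by apply: sumr_ge0 => z _; exact: separation_term_ge0. Qed.

Lemma separation_gt0 : 0 < mixture_div 0 -> 0 < separation.
Proof.
move=> div_gt0; rewrite lt_neqAle separation_ge0 andbT.
apply: contraTneq div_gt0 => /esym/eqP; rewrite psumr_eq0 // => /allP sep0.
rewrite -leNgt oppr_le0; apply: sumr_ge0 => z _.
have := sep0 z (mem_index_enum z); rewrite /= mulf_eq0 gt_eqF ?law_gt0 //= mulf_eq0 invr_eq0.
rewrite [X in _ || X]gt_eqF ?mulr_gt0 ?addr_gt0 ?lratio_gt0 // orbF sqrf_eq0 subr_eq0.
by move=> /eqP l1; rewrite /mixture_lr -l1 subr0 addr0 mulr1 divff ?pnatr_eq0 // ln1 mulr0.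
Qed.

Lemma separation_le x y : `|x| <= 1 -> `|y| <= 1 ->
  separation * (x - y) ^+ 2 <=
  \sum_z law z * (mixture_lr z x * ln (mixture_lr z x / mixture_lr z y)).
Proof.
move=> x1 y1; rewrite /separation mulr_suml.
have -> : \sum_z law z * (mixture_lr z x * ln (mixture_lr z x / mixture_lr z y)) =
    \sum_z law z *
      (mixture_lr z x * ln (mixture_lr z x / mixture_lr z y) - mixture_lr z x + mixture_lr z y).
  under [RHS]eq_bigr do rewrite mulrDr mulrBr.
  by rewrite big_split /= sumrB !sum_law_mixture_lr subrK.
apply: ler_sum => z _; rewrite -mulrA ler_wpM2l ?(ltW (law_gt0 z)) //.
have l1 : 1 + lratio z != 0 by rewrite lt0r_neq0 // addr_gt0 // lratio_gt0.
have -> : (1 - lratio z) ^+ 2 / (16 * (1 + lratio z)) * (x - y) ^+ 2 =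
    (mixture_lr z x - mixture_lr z y) ^+ 2 / (4 * (1 + lratio z)).
  by rewrite /mixture_lr; field.
exact: relative_entropy_ge (mixture_lr_gt0 z x1) (mixture_lr_gt0 z y1)
  (mixture_lr_le z x1) (mixture_lr_le z y1).
Qed.

Lemma mixture_div_ge_tangent : exists2 d : R, d <= 1 &
  forall x, `|x| <= 1 -> mixture_div 0 - d * x <= mixture_div x.
Proof.
exists (\sum_z law z * ((1 - lratio z) / (1 + lratio z))) => [|x x1].
  rewrite -[leRHS](law_sum1 W); apply: ler_sum => z _.
  rewrite ler_piMr ?(ltW (law_gt0 z)) //; have l0 := lratio_gt0 z.
  by rewrite ler_pdivrMr; lra.
rewrite /mixture_div mulr_suml -opprD lerN2 -big_split /=.
apply: ler_sum => z _; have l1 : 0 < 1 + lratio z by rewrite addr_gt0 // lratio_gt0.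
have m0 : 0 < mixture_lr z 0 by rewrite mixture_lr_gt0 // normr0.
rewrite -mulrA -mulrDr ler_wpM2l ?(ltW (law_gt0 z)) // -lerBlDl.
rewrite -ln_div ?posrE ?m0 ?mixture_lr_gt0 //.
have -> : (1 - lratio z) / (1 + lratio z) * x = mixture_lr z x / mixture_lr z 0 - 1.
  by rewrite /mixture_lr addr0 subr0 mul1r; field; rewrite lt0r_neq0.
by apply: ln_le_subr1; rewrite divr_gt0 // mixture_lr_gt0.
Qed.

End SymmetricChannel.

Section Code.
Variables (R : realType) (W : symmetric_channel R).
Variables (I : finType) (C : {set {ffun I -> bool}}).
Implicit Types (u v : {ffun I -> bool}) (y : {ffun I -> W}) (o : I).

Definition flip u y : {ffun I -> W} := [ffun i => if u i then mirror (y i) else y i].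

Definition word_lr u y : R := \prod_i (if u i then lratio (y i) else 1).

Definition code_lr y : R := \sum_(u in C) word_lr u y.

Definition signed_code_lr o y : R := \sum_(u in C) (-1) ^+ (u o) * word_lr u y.

Definition posterior_mean o y : R := signed_code_lr o y / code_lr y.

Definition equivariant o (g : {ffun I -> W} -> R) : Prop :=
  forall v y, v \in C -> g (flip v y) = (-1) ^+ (v o) * g y.

Hypothesis C_linear : zmod_closed C.

Lemma card_code_gt0 : 0 < #|C|%:R :> R.
Proof. by rewrite ltr0n; apply/card_gt0P; exists 0; case: C_linear. Qed.

Lemma flipK u : involutive (flip u).
Proof. by move=> y; apply/ffunP => i; rewrite !ffunE; case: (u i); rewrite ?mirrorK. Qed.

Lemma word_lr_gt0 u y : 0 < word_lr u y.
Proof. by apply: prodr_gt0 => i _; case: ifP => // _; exact: lratio_gt0. Qed.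

Lemma word_lr_flip u v y : word_lr u (flip v y) * word_lr v y = word_lr (u + v) y.
Proof.
rewrite -big_split /=; apply: eq_bigr => i _; rewrite !ffunE.
case: (v i); case: (u i); rewrite /= ?mul1r ?mulr1 //.
by rewrite lratio_mirror mulVf // lt0r_neq0 // lratio_gt0.
Qed.

Lemma code_lr_ge1 y : 1 <= code_lr y.
Proof.
have [C0 _] := C_linear; rewrite /code_lr (bigD1 _ C0) /=.
rewrite [word_lr 0 y]big1 => [|i _]; last by rewrite ffunE.
by rewrite lerDl; apply: sumr_ge0 => u _; exact/ltW/word_lr_gt0.
Qed.

Lemma code_lr_gt0 y : 0 < code_lr y.
Proof. exact: lt_le_trans ltr01 (code_lr_ge1 y). Qed.

Lemma sum_code_shift v (F : {ffun I -> bool} -> R) : v \in C ->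
  \sum_(u in C) F (u + v) = \sum_(u in C) F u.
Proof.
move=> vC; rewrite [RHS](reindex_inj (addIr v)); apply: eq_bigl => u.
have [_ CB] := C_linear; have [_ CD] := GRing.zmod_closedD C_linear.
by apply/idP/idP => uC; [exact: CD | rewrite -(addrK v u); exact: CB].
Qed.

Lemma code_lr_flip v y : v \in C -> code_lr (flip v y) * word_lr v y = code_lr y.
Proof.
move=> vC; rewrite mulr_suml -[RHS](sum_code_shift _ vC).
by apply: eq_bigr => u _; rewrite word_lr_flip.
Qed.

Lemma signed_code_lr_flip o v y : v \in C ->
  signed_code_lr o (flip v y) * word_lr v y = (-1) ^+ (v o) * signed_code_lr o y.
Proof.
move=> vC; rewrite mulr_suml /signed_code_lr -[in RHS](sum_code_shift _ vC) mulr_sumr.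
apply: eq_bigr => u _; rewrite -mulrA word_lr_flip mulrA; congr (_ * _).
by rewrite ffunE signr_addb mulrCA -expr2 sqrr_sign mulr1.
Qed.

Lemma posterior_mean_equivariant o : equivariant o (posterior_mean o).
Proof.
move=> v y vC; rewrite /posterior_mean mulrA -(signed_code_lr_flip _ _ vC).
by rewrite -(code_lr_flip y vC) invfM mulrACA divff ?mulr1 // lt0r_neq0 // word_lr_gt0.
Qed.

Lemma posterior_mean_le1 o y : `|posterior_mean o y| <= 1.
Proof.
rewrite normrM normfV (gtr0_norm (code_lr_gt0 y)) ler_pdivrMr ?code_lr_gt0 // mul1r.
apply: le_trans (ler_norm_sum _ _ _) _; apply: ler_sum => u _.
by rewrite normrM normr_sign mul1r gtr0_norm ?word_lr_gt0.
Qed.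

Lemma code_lr_posterior_mean o y : code_lr y * posterior_mean o y = signed_code_lr o y.
Proof. by rewrite mulrCA divff ?mulr1 // lt0r_neq0 // code_lr_gt0. Qed.

Section SymmetricLaw.
Variable q : I -> W -> R.
Hypothesis q_sym : forall i, symmetric_law (q i).

Let q_pmf i : pmf (q i). Proof. by case: (q_sym i). Qed.

(* Weighting by [word_lr v] turns the outputs of the zero codeword into those of [v]. *)
Lemma expect_word_lr v F :
  expect q (fun y => word_lr v y * F y) = expect q (fun y => F (flip v y)).
Proof.
rewrite /expect [RHS](reindex_inj (inv_inj (flipK v))) /=.
apply: eq_bigr => y _; rewrite flipK mulrA -big_split /=; congr (_ * _).
apply: eq_bigr => i _; rewrite ffunE; case: ifP => _; last by rewrite mulr1.
by case: (q_sym i) => _ ->.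
Qed.

Lemma expect_code_lr F : (forall v y, v \in C -> F (flip v y) = F y) ->
  expect q (fun y => code_lr y * F y) = #|C|%:R * expect q F.
Proof.
move=> F_inv; under eq_expect do rewrite mulr_suml.
rewrite expect_sum (eq_bigr (fun=> expect q F)) ?sumr_const ?mulr_natl // => u uC.
by rewrite expect_word_lr; apply: eq_expect => y; rewrite F_inv.
Qed.

(* Given the output, the sign of the code bit [o] of a uniform codeword has mean
   [posterior_mean o]. *)
Lemma expect_symmetrize o (h : R -> R -> R) g : equivariant o g ->
  let f := posterior_mean o in
  expect q (fun y => h (f y) (g y)) =
  expect q (fun y => (1 + f y) / 2 * h (f y) (g y) + (1 - f y) / 2 * h (- f y) (- g y)).
Proof.
move=> g_eqv f; have f_eqv : equivariant o f := posterior_mean_equivariant o.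
apply: (mulfI (lt0r_neq0 card_code_gt0)); rewrite -[in RHS]expect_code_lr; last first.
  move=> v y vC; rewrite f_eqv // g_eqv //; case: (v o); last by rewrite !mul1r.
  by rewrite !mulN1r !opprK [RHS]addrC.
transitivity (\sum_(u in C)
  expect q (fun y => word_lr u y * h ((-1) ^+ u o * f y) ((-1) ^+ u o * g y))).
  rewrite mulr_natl -sumr_const; apply: eq_bigr => u uC; rewrite expect_word_lr.
  by apply: eq_expect => y; rewrite f_eqv // g_eqv // !mulrA -expr2 sqrr_sign !mul1r.
rewrite -expect_sum; apply: eq_expect => y.
pose h0 := h (f y) (g y); pose h1 := h (- f y) (- g y).
transitivity (\sum_(u in C) (word_lr u y * ((h0 + h1) / 2) +
  (-1) ^+ u o * word_lr u y * ((h0 - h1) / 2))).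
  by apply: eq_bigr => u _; case: (u o); rewrite ?mulN1r ?mul1r -/h0 -/h1; field.
rewrite big_split /= -!mulr_suml -[X in _ + X * _]/(signed_code_lr o y).
by rewrite -code_lr_posterior_mean -/(code_lr y) -/(f y) -/h0 -/h1; field.
Qed.

Lemma expect_posterior_mean_mul o g : equivariant o g ->
  expect q (fun y => posterior_mean o y * g y) = expect q g.
Proof.
move=> g_eqv; rewrite (expect_symmetrize (fun _ x => x) g_eqv).
by apply: eq_expect => y; field.
Qed.

Lemma expect_posterior_mean_sqr o :
  expect q (fun y => posterior_mean o y ^+ 2) = expect q (posterior_mean o).
Proof.
by rewrite -(expect_posterior_mean_mul (@posterior_mean_equivariant o)).
Qed.

Lemma expect_mixture_div_separation o g : equivariant o g -> (forall y, `|g y| <= 1) ->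
  separation W * expect q (fun y => (posterior_mean o y - g y) ^+ 2) <=
  expect q (fun y => mixture_div W (g y)) -
  expect q (fun y => mixture_div W (posterior_mean o y)).
Proof.
move=> g_eqv g1; have f1 := posterior_mean_le1 o.
pose lnratio x x' := \sum_(z : W) law z * ln (mixture_lr z x / mixture_lr z x').
rewrite -expectB -expectZ; under [leRHS]eq_expect do rewrite mixture_divB //.
rewrite (expect_symmetrize lnratio g_eqv); apply: ler_expect => // y.
apply: le_trans (separation_le W (f1 y) (g1 y)) _.
rewrite /lnratio sum_law_mixture_lr_lnN !mulr_sumr -big_split /=.
by apply: ler_sum => z _; rewrite [X in X * ln _]/mixture_lr; lra.
Qed.

Lemma expect_mixture_div_le o g : equivariant o g -> (forall y, `|g y| <= 1) ->
  expect q (fun y => mixture_div W (posterior_mean o y)) <=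
  expect q (fun y => mixture_div W (g y)).
Proof.
move=> g_eqv g1; rewrite -subr_ge0.
apply: le_trans (expect_mixture_div_separation g_eqv g1).
by rewrite mulr_ge0 ?separation_ge0 // expect_ge0 // => y; exact: sqr_ge0.
Qed.

Lemma expect_mixture_div_ge o : mixture_div W 0 - expect q (posterior_mean o) <=
  expect q (fun y => mixture_div W (posterior_mean o y)).
Proof.
have [d d1 tangent] := mixture_div_ge_tangent W.
have mean_ge0 : 0 <= expect q (posterior_mean o).
  by rewrite -expect_posterior_mean_sqr expect_ge0 // => y; exact: sqr_ge0.
apply: (@le_trans _ _ (expect q (fun y => mixture_div W 0 - d * posterior_mean o y))).
  by rewrite expectB expectZ expect_cst // lerD2l lerN2 ler_piMl.
by apply: ler_expect => // y; exact/tangent/posterior_mean_le1.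
Qed.

End SymmetricLaw.
End Code.

(** * The erasure path *)

Section Erasure.
Variables (R : realType) (W : symmetric_channel R).

Definition erased_law (z : W) : R := (z == erasure W)%:R.

Definition erasure_law (I : finType) (O : {set I}) (t : R) (i : I) : W -> R :=
  fun z => if i \in O then erased_law z else (1 - t) * erased_law z + t * law z.

Definition erase (I : finType) (i : I) (y : {ffun I -> W}) : {ffun I -> W} :=
  ffun_upd y i (erasure W).

Lemma erased_law_symmetric : symmetric_law erased_law.
Proof.
split; first split=> [z|]; first exact: ler0n.
  rewrite -[RHS](sumr_indicator (erasure W) (fun=> 1)).
  by apply: eq_bigr => z _; rewrite mulr1.
move=> z; rewrite /erased_law -{1}(mirror_erasure W) (inj_eq (inv_inj (@mirrorK R W))).
by case: eqP => [->|_]; rewrite ?lratio_erasure ?mulr1 // mul0r.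
Qed.

Section OneIndexSet.
Variable I : finType.
Implicit Types (O : {set I}) (i : I) (q : I -> W -> R) (F : {ffun I -> W} -> R) (t : R).

Lemma sum_erasure_law O t i : \sum_z erasure_law O t i z = 1.
Proof.
rewrite /erasure_law; have [[_ erased1] _] := erased_law_symmetric.
by case: (i \in O) => //; rewrite big_split /= -!mulr_sumr erased1 law_sum1; ring.
Qed.

Lemma erasure_law_symmetric O t i : 0 <= t <= 1 -> symmetric_law (erasure_law O t i).
Proof.
move=> /andP[t0 t1]; have [[erased0 _] erased_mirror] := erased_law_symmetric.
have [[law0 _] law_mirror] := law_symmetric W.
split; first split=> [z|].
- rewrite /erasure_law; case: ifP => // _.
  by rewrite addr_ge0 // mulr_ge0 // subr_ge0.
- exact: sum_erasure_law.
- move=> z; rewrite /erasure_law; case: ifP => // _.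
  by rewrite erased_mirror law_mirror; ring.
Qed.

Lemma law_upd_symmetric q i p : (forall j, symmetric_law (q j)) -> symmetric_law p ->
  forall j, symmetric_law (law_upd q i p j).
Proof. by move=> q_sym p_sym j; rewrite /law_upd; case: eqP. Qed.

Lemma expect_erase q i F : \sum_z q i z = 1 ->
  expect q (fun y => F (erase i y)) = expect (law_upd q i erased_law) F.
Proof.
move=> q_sum1; rewrite expect_law_upd //; apply: eq_expect => y.
by rewrite (sumr_indicator _ (fun z => F (ffun_upd y i z))).
Qed.

Lemma erasure_lawU1 O t i p :
  law_upd (law_upd (erasure_law O t) i p) i erased_law =2 erasure_law (i |: O) t.
Proof. by move=> j z; rewrite /law_upd /erasure_law in_setU1; case: eqP. Qed.

Lemma is_derive_erasure_law O F t : is_derive t 1 (fun s => expect (erasure_law O s) F)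
  (\sum_(i | i \notin O) (expect (law_upd (erasure_law O t) i (@law R W)) F -
                          expect (erasure_law (i |: O) t) F)).
Proof.
pose dq i (z : W) : R := if i \in O then 0 else law z - erased_law z.
have law_dq i z : is_derive t 1 (fun s => erasure_law O s i z) (dq i z).
  rewrite /erasure_law /dq; case: ifP => _; first exact: is_derive_cst.
  rewrite (_ : (fun _ => _) = cst (erased_law z) + (law z - erased_law z) \*: id); last first.
    by apply/funext => s; rewrite /= -[RHS]/(erased_law z + (law z - erased_law z) * s); ring.
  by apply: is_derive_eq; rewrite add0r -[LHS]/(_ * _) mulr1.
apply: (is_derive_eq (is_derive_expect F law_dq)).
rewrite (bigID (mem O)) /= big1 ?add0r => [|i iO].
  apply: eq_bigr => i /negPf iO; rewrite /dq iO expect_law_updB; congr (_ - _).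
  by apply: eq_expect_law => j z; rewrite -(erasure_lawU1 O t i (@law R W)) /law_upd; case: eqP.
by rewrite /dq iO expect_law_upd0.
Qed.

Lemma expect_erasure_law_nondecreasing O F :
  (forall t i, 0 <= t <= 1 ->
     let q := law_upd (erasure_law O t) i (@law R W) in
     expect q (fun y => F (erase i y)) <= expect q F) ->
  forall a b, 0 <= a -> a <= b -> b <= 1 ->
  expect (erasure_law O a) F <= expect (erasure_law O b) F.
Proof.
move=> erase_le a b a0; rewrite le_eqVlt => /orP[/eqP -> //|ab] b1.
have [c [ac cb increment]] := is_derive_MVT ab (is_derive_erasure_law O F).
rewrite -subr_ge0 increment mulr_ge0 ?subr_ge0 ?(ltW ab) //.
apply: sumr_ge0 => i iO; rewrite subr_ge0 -(eq_expect_law _ (erasure_lawU1 O c i (@law R W))).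
rewrite -expect_erase; last by rewrite /law_upd eqxx law_sum1.
by apply: erase_le; rewrite (le_trans a0 (ltW ac)) (le_trans (ltW cb) b1).
Qed.

End OneIndexSet.

Section ErasedCode.
Variables (I : finType) (C : {set {ffun I -> bool}}).
Hypothesis C_linear : zmod_closed C.
Implicit Types (o i : I) (t : R) (q : I -> W -> R) (y : {ffun I -> W}).

(* The mutual information, in nats, between a uniform codeword and its output
   when each symbol is erased with probability [1 - t]. *)
Definition code_info t : R :=
  ln #|C|%:R - expect (erasure_law finset.set0 t) (fun y => ln (code_lr C y)).

(* Both notions refer to the bit [o] with its own output erased. *)
Definition extrinsic_info o t : R :=
  expect (erasure_law [set o] t) (fun y => mixture_div W (posterior_mean C o y)).

Definition extrinsic_mean o t : R := expect (erasure_law [set o] t) (posterior_mean C o).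

Lemma erase_equivariant o i (g : {ffun I -> W} -> R) : equivariant C o g ->
  equivariant C o (fun y => g (erase i y)).
Proof.
move=> g_eqv v y vC; rewrite -g_eqv //; congr g.
by apply/ffunP => j; rewrite !ffunE; case: eqP => // _; rewrite mirror_erasure if_same.
Qed.

Lemma expect_posterior_mean_erase_le q o i : (forall j, symmetric_law (q j)) ->
  expect q (fun y => posterior_mean C o (erase i y)) <= expect q (posterior_mean C o).
Proof.
move=> q_sym; set f := posterior_mean C o; pose g y := f (erase i y).
have g_eqv : equivariant C o g by exact/erase_equivariant/posterior_mean_equivariant.
have [[_ q_sum1] _] := q_sym i.
have g_sqr : expect q (fun y => g y ^+ 2) = expect q g.
  rewrite (expect_erase (fun y => f y ^+ 2) q_sum1) (expect_erase f q_sum1).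
  apply: expect_posterior_mean_sqr => // j.
  exact: law_upd_symmetric erased_law_symmetric j.
have f_sqr := expect_posterior_mean_sqr C_linear q_sym o; rewrite -/f in f_sqr.
have fg := expect_posterior_mean_mul C_linear q_sym g_eqv; rewrite -/f in fg.
have : 0 <= expect q (fun y => (f y - g y) ^+ 2).
  by apply: expect_ge0 => [j|y]; [case: (q_sym j) | exact: sqr_ge0].
have -> : expect q (fun y => (f y - g y) ^+ 2) =
    expect q (fun y => f y ^+ 2) - 2 * expect q (fun y => f y * g y) +
    expect q (fun y => g y ^+ 2).
  by rewrite -expectZ -expectB -expectD; apply: eq_expect => y; ring.
by rewrite f_sqr fg g_sqr; lra.
Qed.

Lemma extrinsic_mean_nondecreasing o a b : 0 <= a -> a <= b -> b <= 1 ->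
  extrinsic_mean o a <= extrinsic_mean o b.
Proof.
apply: expect_erasure_law_nondecreasing => t i t01; apply: expect_posterior_mean_erase_le.
apply: law_upd_symmetric (law_symmetric W) => j; exact: erasure_law_symmetric.
Qed.

Lemma extrinsic_info_nonincreasing o a b : 0 <= a -> a <= b -> b <= 1 ->
  extrinsic_info o b <= extrinsic_info o a.
Proof.
move=> a0 ab b1; rewrite -lerN2 -!expectN; apply: expect_erasure_law_nondecreasing => // t i t01.
rewrite /= [leLHS]expectN [leRHS]expectN lerN2.
apply: (expect_mixture_div_le C_linear _ (g := fun y => posterior_mean C o (erase i y))).
- apply: law_upd_symmetric (law_symmetric W) => j; exact: erasure_law_symmetric.
- exact/erase_equivariant/posterior_mean_equivariant.
- by move=> y; exact: posterior_mean_le1.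
Qed.

Lemma extrinsic_mean_le1 o t : 0 <= t <= 1 -> extrinsic_mean o t <= 1.
Proof.
move=> t01; have q_pmf i := (erasure_law_symmetric [set o] i t01).1.
rewrite -[leRHS](expect_cst _ q_pmf); apply: ler_expect => // y.
by have := posterior_mean_le1 C_linear o y; rewrite ler_norml => /andP[].
Qed.

Lemma code_lr_upd y i z : y i = erasure W ->
  code_lr C (ffun_upd y i z) = code_lr C y * mixture_lr z (posterior_mean C i y).
Proof.
move=> yi; transitivity ((code_lr C y + signed_code_lr C i y) / 2 +
    (code_lr C y - signed_code_lr C i y) / 2 * lratio z); last first.
  by rewrite -(code_lr_posterior_mean C_linear) /mixture_lr; field.
transitivity (\sum_(u in C) (word_lr u y * ((1 + lratio z) / 2) +
    (-1) ^+ u i * word_lr u y * ((1 - lratio z) / 2))); last first.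
  by rewrite big_split /= -!mulr_suml -/(code_lr C y) -/(signed_code_lr C i y); field.
apply: eq_bigr => u _; rewrite /word_lr (bigD1 i) //= ffun_updE.
rewrite [in RHS](bigD1 i) //= yi lratio_erasure if_same mul1r.
under eq_bigr => j /negPf ji do rewrite ffunE ji.
by case: (u i); rewrite ?expr1 ?expr0; field.
Qed.

Lemma is_derive_code_info t : is_derive t 1 code_info (\sum_i extrinsic_info i t).
Proof.
apply: (is_derive_eq (is_deriveB (is_derive_cst (ln #|C|%:R : R) t 1)
  (is_derive_erasure_law finset.set0 (fun y => ln (code_lr C y)) t))).
rewrite sub0r -sumrN; apply: eq_big => [i|i _]; first by rewrite inE.
rewrite finset.setU0 opprB.
have -> : expect (law_upd (erasure_law finset.set0 t) i (@law R W)) (fun y => ln (code_lr C y)) =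
    expect (law_upd (erasure_law [set i] t) i (@law R W)) (fun y => ln (code_lr C y)).
  apply: eq_expect_law => j z; rewrite /law_upd; case: eqP => // /eqP/negPf ji.
  by rewrite /erasure_law !inE ji.
rewrite expect_law_upd ?sum_erasure_law // -expectB; apply: (@expect_dirac _ _ _ _ i (erasure W)).
  by move=> z /negPf ze; rewrite /erasure_law inE eqxx /erased_law ze.
move=> y yi; rewrite /mixture_div -[ln (code_lr C y)]mul1r -(law_sum1 W) mulr_suml.
rewrite -sumrB -sumrN; apply: eq_bigr => z _.
by rewrite code_lr_upd // lnM ?posrE ?code_lr_gt0 ?mixture_lr_gt0 ?posterior_mean_le1 //; ring.
Qed.

Lemma code_info0 : code_info 0 = 0.
Proof.
apply/eqP; rewrite subr_eq0 eq_sym; apply/eqP.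
have code_lr_erased y : (forall i, y i = erasure W) -> code_lr C y = #|C|%:R.
  move=> yE; rewrite /code_lr (eq_bigr (fun=> 1)) ?sumr_const // => u _.
  by apply: big1 => i _; rewrite yE lratio_erasure if_same.
have t01 : 0 <= (0 : R) <= 1 by rewrite lexx ler01.
have q_pmf i := (erasure_law_symmetric finset.set0 i t01).1.
rewrite -[RHS](expect_cst _ q_pmf).
apply: eq_bigr => y _; have [/forallP yE|] := boolP [forall i, y i == erasure W].
  by rewrite code_lr_erased // => i; apply/eqP.
rewrite negb_forall => /existsP[i /negPf yi].
by rewrite (bigD1 i) //= /erasure_law inE /erased_law yi mulr0 !mul0r addr0 !mul0r.
Qed.

Lemma code_info_le t : 0 <= t <= 1 -> code_info t <= ln #|C|%:R.
Proof.
move=> t01; rewrite gerBl; apply: expect_ge0 => [i|y].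
  by case: (erasure_law_symmetric finset.set0 i t01).
exact/ln_ge0/code_lr_ge1.
Qed.

Definition automorphism (h : I -> I) : Prop :=
  injective h /\ forall u, u \in C -> ffun_comp u h \in C.

Section Automorphism.
Variable h : I -> I.
Hypothesis h_aut : automorphism h.

Let h_inj : injective h. Proof. by case: h_aut. Qed.

Lemma sum_code_comp (F : {ffun I -> bool} -> R) :
  \sum_(u in C) F (ffun_comp u h) = \sum_(u in C) F u.
Proof.
have CE : [set ffun_comp u h | u in C] = C.
  apply/eqP; rewrite eqEcard card_imset ?leqnn ?andbT; last exact: ffun_comp_inj.
  by apply/fintype.subsetP => _ /imsetP[u uC ->]; exact: h_aut.2.
by rewrite -[in RHS]CE big_imset //= => u v _ _; exact: ffun_comp_inj.
Qed.

Lemma word_lr_comp u y : word_lr (ffun_comp u h) (ffun_comp y h) = word_lr u y.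
Proof. by rewrite [RHS](reindex_inj h_inj); apply: eq_bigr => i _; rewrite !ffunE. Qed.

Lemma posterior_mean_comp o y : posterior_mean C (h o) y = posterior_mean C o (ffun_comp y h).
Proof.
congr (_ / _); rewrite -[RHS]sum_code_comp; apply: eq_bigr => u _; rewrite word_lr_comp //.
by rewrite ffunE.
Qed.

Lemma expect_erasure_law_comp o t F :
  expect (erasure_law [set h o] t) (fun y => F (ffun_comp y h)) =
  expect (erasure_law [set o] t) F.
Proof.
rewrite expect_comp //; apply: eq_expect_law => i z.
by rewrite /erasure_law !inE (inj_eq h_inj).
Qed.

Lemma extrinsic_info_comp o t : extrinsic_info (h o) t = extrinsic_info o t.
Proof.
rewrite /extrinsic_info -(expect_erasure_law_comp o t).
by apply: eq_expect => y; rewrite posterior_mean_comp.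
Qed.

Lemma extrinsic_mean_comp o t : extrinsic_mean (h o) t = extrinsic_mean o t.
Proof.
rewrite /extrinsic_mean -(expect_erasure_law_comp o t).
by apply: eq_expect => y; rewrite posterior_mean_comp.
Qed.

End Automorphism.

Section Transitive.
Variable o : I.
Hypothesis transitive : forall i, exists2 h, automorphism h & h o = i.

Lemma sum_extrinsic_info t : \sum_i extrinsic_info i t = #|I|%:R * extrinsic_info o t.
Proof.
rewrite (eq_bigr (fun=> extrinsic_info o t)) ?sumr_const ?mulr_natl // => i _.
by have [h h_aut <-] := transitive i; rewrite extrinsic_info_comp.
Qed.

(* Otherwise [extrinsic_info] would stay above [mixture_div W 0 - theta] on
   [0, t], and its integral [code_info t] would exceed [ln #|C|]. *)
Lemma extrinsic_mean_gt theta t : 0 < t -> t <= 1 ->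
  ln #|C|%:R < #|I|%:R * (t * (mixture_div W 0 - theta)) -> theta < extrinsic_mean o t.
Proof.
move=> t0 t1; apply: contraTT; rewrite -!leNgt => mean_le.
have t01 : 0 <= t <= 1 by rewrite ltW.
have [c [c0 ct increment]] := is_derive_MVT t0 is_derive_code_info.
rewrite code_info0 !subr0 sum_extrinsic_info in increment.
apply: le_trans (code_info_le t01); rewrite increment -mulrA [_ * t]mulrC.
apply: ler_wpM2l => //; apply: ler_wpM2l; first exact: ltW.
apply: le_trans (extrinsic_info_nonincreasing o (ltW c0) (ltW ct) t1).
apply: le_trans (expect_mixture_div_ge C_linear _ o) => [|i]; first by rewrite lerD2l lerN2.
exact: erasure_law_symmetric.
Qed.

End Transitive.
End ErasedCode.
End Erasure.

(** * The Plotkin extension and the sharp threshold *)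

Section Plotkin.
Variables (R : realType) (W : symmetric_channel R) (J : finType).
Variables (C C1 : {set {ffun J -> bool}}) (o : J).
Hypothesis C_linear : zmod_closed C.
Hypothesis C1_linear : zmod_closed C1.
Hypothesis C1_sub : C1 \subset C.
Hypothesis transitive : forall v, exists h, [/\ automorphism C h, automorphism C1 h & h o = v].
Implicit Types (u v b : {ffun J -> bool}) (t : R).

Definition plotkin_word u v : {ffun J * bool -> bool} := [ffun i => u i.1 (+) (i.2 && v i.1)].

Definition plotkin_code : {set {ffun J * bool -> bool}} :=
  [set plotkin_word x.1 x.2 | x in finset.setX C C1].

Definition graph_restr (S : Type) b (y : {ffun J * bool -> S}) : {ffun J -> S} :=
  ffun_comp y (fun j => (j, b j)).

Definition zero_set b : {set J} := [set j | ~~ b j].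

Let C0 : 0 \in C. Proof. by case: C_linear. Qed.
Let CD u v : u \in C -> v \in C -> u + v \in C.
Proof. exact: (GRing.zmod_closedD C_linear).2. Qed.

Lemma graph_restr0 (S : Type) (y : {ffun J * bool -> S}) :
  graph_restr 0 y = ffun_comp y (pair^~ false).
Proof. by apply/ffunP => j; rewrite !ffunE. Qed.

Lemma graph_restr1 (S : Type) (y : {ffun J * bool -> S}) :
  graph_restr 1 y = ffun_comp y (pair^~ true).
Proof. by apply/ffunP => j; rewrite !ffunE. Qed.

Lemma plotkin_word_inj : injective (fun x => plotkin_word x.1 x.2).
Proof.
case=> u v [u' v'] /ffunP wordE.
have uE : u = u' by apply/ffunP => j; have := wordE (j, false); rewrite !ffunE /= !addbF.
congr pair => //; apply/ffunP => j.
by have := wordE (j, true); rewrite !ffunE /= uE => /addbI.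
Qed.

Lemma card_plotkin_code : #|plotkin_code| = (#|C| * #|C1|)%N.
Proof. by rewrite card_imset ?cardsX //; exact: plotkin_word_inj. Qed.

Lemma mem_plotkin_code u v : u \in C -> v \in C1 -> plotkin_word u v \in plotkin_code.
Proof. by move=> uC vC1; apply/imsetP; exists (u, v); rewrite ?inE ?uC. Qed.

Lemma plotkin_codeP x : x \in plotkin_code ->
  exists u v, [/\ u \in C, v \in C1 & x = plotkin_word u v].
Proof. by move=> /imsetP[[u v] /setXP[uC vC1] ->]; exists u, v. Qed.

Lemma plotkin_code_linear : zmod_closed plotkin_code.
Proof.
have [C1_0 C1_B] := C1_linear; have [_ C_B] := C_linear; split.
  rewrite (_ : 0 = plotkin_word 0 0) ?mem_plotkin_code //.
  by apply/ffunP => i; rewrite !ffunE andbF.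
move=> _ _ /plotkin_codeP[u [v [uC vC ->]]] /plotkin_codeP[u' [v' [uC' vC' ->]]].
rewrite (_ : _ - _ = plotkin_word (u - u') (v - v')) ?mem_plotkin_code ?C_B ?C1_B //.
by apply/ffunP => -[j []]; rewrite !ffunE //= ?addbF // [LHS]addbACA.
Qed.

Lemma plotkin_code_transitive i :
  exists2 h, automorphism plotkin_code h & h (o, false) = i.
Proof.
case: i => j b; have [h [[h_inj Ch] [_ C1h] <-]] := transitive j.
exists (fun i => (h i.1, i.2 (+) b)) => //; split.
  by case=> k c [k' c'] [/h_inj -> /addIb ->].
move=> _ /plotkin_codeP[u [v [uC vC1 ->]]].
rewrite (_ : ffun_comp _ _ =
    plotkin_word (ffun_comp u h + if b then ffun_comp v h else 0) (ffun_comp v h)).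
  rewrite mem_plotkin_code ?C1h // CD ?Ch //; case: b => //.
  exact: (fintype.subsetP C1_sub) (C1h _ _).
apply/ffunP => -[k c]; rewrite !ffunE /=; case: b; rewrite !ffunE /= ?addbF ?addr0 //.
by case: c; case: (u _); case: (v _).
Qed.

Lemma expect_erasure_law_pair t (F : {ffun J -> W} -> {ffun J -> W} -> R) :
  expect (erasure_law [set (o, false)] t) (fun y => F (graph_restr 0 y) (graph_restr 1 y)) =
  expect (erasure_law [set o] t) (fun y0 => expect (erasure_law finset.set0 t) (F y0)).
Proof.
under eq_expect do rewrite graph_restr0 graph_restr1.
rewrite (expect_pair_bool _ F).
rewrite (@eq_expect_law _ _ _ _ (erasure_law [set o] t)); last first.
  by move=> j z; rewrite /erasure_law !inE xpair_eqE eqxx andbT.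
apply: eq_expect => y0; apply: eq_expect_law => j z.
by rewrite /erasure_law !inE xpair_eqE andbF.
Qed.

Lemma graph_restr_splice b (y : {ffun J * bool -> W}) :
  graph_restr b y = splice (zero_set b) (graph_restr 0 y) (graph_restr 1 y).
Proof. by apply/ffunP => j; rewrite !ffunE /zero_set inE; case: (b j). Qed.

Definition erased_mean (y : {ffun J -> W}) : R := posterior_mean C o (erase o y).

Lemma expect_erased_mean t (k : R -> R) : expect (erasure_law [set o] t)
    (fun y => k (erased_mean y)) =
  expect (erasure_law [set o] t) (fun y : {ffun J -> W} => k (posterior_mean C o y)).
Proof.
apply: (@expect_dirac _ _ _ _ o (erasure W)) => [z /negPf ze|y yo].
  by rewrite /erasure_law inE eqxx /erased_law ze.
by rewrite /erased_mean /erase -[in ffun_upd _ _ _]yo ffun_upd_id.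
Qed.

Section MultiplierGraph.
Variables (b : {ffun J -> bool}) (t : R).
Hypothesis b_o : b o = false.
Hypothesis b_mul : forall u, u \in C1 -> b * u \in C.
Hypothesis t01 : 0 <= t <= 1.

Let q_pmf i : pmf (@erasure_law R W J [set o] t i).
Proof. by case: (erasure_law_symmetric W [set o] i t01). Qed.

Lemma graph_restr_mem x : x \in plotkin_code -> graph_restr b x \in C.
Proof.
move=> /plotkin_codeP[u [v [uC vC1 ->]]].
rewrite (_ : graph_restr _ _ = u + b * v) ?CD ?b_mul //.
by apply/ffunP => j; rewrite !ffunE.
Qed.

Lemma graph_restr_equivariant (g : {ffun J -> W} -> R) : equivariant C o g ->
  equivariant plotkin_code (o, false) (fun y => g (graph_restr b y)).
Proof.
move=> g_eqv x y xC; rewrite (_ : graph_restr b _ = flip (graph_restr b x) (graph_restr b y)).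
  by rewrite g_eqv ?graph_restr_mem // ffunE b_o.
by apply/ffunP => j; rewrite !ffunE.
Qed.

Lemma expect_splice_erasure_law (G : {ffun J -> W} -> R) y0 :
  expect (erasure_law finset.set0 t) (fun y => G (splice (zero_set b) y0 y)) =
  expect (erasure_law [set o] t) (fun y => G (splice (zero_set b) y0 y)).
Proof.
rewrite -(@expect_law_upd_free _ W _ (@erasure_law R W J finset.set0 t) o (@erased_law R W)).
- apply: eq_expect_law => j z; rewrite /law_upd /erasure_law !inE.
  by case: eqP.
- exact: sum_erasure_law.
- by case: (erased_law_symmetric W) => -[].
- by move=> y z; rewrite splice_updr /zero_set inE b_o.
Qed.

Lemma expect_graph_restr (F : {ffun J -> W} -> R) :
  expect (erasure_law [set (o, false)] t) (fun y => F (graph_restr b y)) =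
  expect (erasure_law [set o] t) F.
Proof.
under eq_expect do rewrite (graph_restr_splice b).
rewrite (expect_erasure_law_pair t (fun y0 y1 => F (splice _ y0 y1))).
under eq_expect do rewrite expect_splice_erasure_law.
exact: expect_splice.
Qed.

Lemma expect_graph_restr_mul (F : {ffun J -> W} -> R) :
  expect (erasure_law [set (o, false)] t)
    (fun y => F (graph_restr 0 y) * F (graph_restr b y)) =
  splice_corr (erasure_law [set o] t) (zero_set b) F F.
Proof.
under eq_expect do rewrite (graph_restr_splice b).
rewrite (expect_erasure_law_pair t (fun y0 y1 => F y0 * F (splice _ y0 y1))).
by apply: eq_expect => y0; exact: (expect_splice_erasure_law (fun y => F y0 * F y)).
Qed.

Lemma separation_graph_restr :
  separation W * expect (erasure_law [set (o, false)] t)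
    (fun y : {ffun J * bool -> W} =>
      (posterior_mean plotkin_code (o, false) y - erased_mean (graph_restr b y)) ^+ 2) <=
  extrinsic_info W C o t - extrinsic_info W plotkin_code (o, false) t.
Proof.
rewrite /extrinsic_info -(expect_erased_mean t (mixture_div W)).
rewrite -(expect_graph_restr (fun y => mixture_div W (erased_mean y))).
apply: expect_mixture_div_separation => [|i||y].
- exact: plotkin_code_linear.
- exact: erasure_law_symmetric.
- exact/graph_restr_equivariant/erase_equivariant/posterior_mean_equivariant.
- exact: posterior_mean_le1.
Qed.

End MultiplierGraph.

Section AtTime.
Variable t : R.
Hypothesis t01 : 0 <= t <= 1.

Let q : J -> W -> R := erasure_law [set o] t.
Let Q : J * bool -> W -> R := erasure_law [set (o, false)] t.
Let q_sym i : symmetric_law (q i). Proof. exact: erasure_law_symmetric. Qed.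
Let q_pmf i : pmf (q i). Proof. by case: (q_sym i). Qed.
Let Q_pmf i : pmf (Q i). Proof. by case: (erasure_law_symmetric W [set (o, false)] i t01). Qed.

Let zero_o : (0 : {ffun J -> bool}) o = false. Proof. by rewrite ffunE. Qed.
Let zero_mul u : u \in C1 -> 0 * u \in C. Proof. by rewrite mul0r. Qed.
Let info_gap := extrinsic_info W C o t - extrinsic_info W plotkin_code (o, false) t.

Lemma extrinsic_info_plotkin_le : 0 <= info_gap.
Proof.
apply: le_trans (separation_graph_restr zero_o zero_mul t01).
by rewrite mulr_ge0 ?separation_ge0 // expect_ge0 // => y; exact: sqr_ge0.
Qed.

Let mean_erased_sqr : expect q (fun y => erased_mean y ^+ 2) = extrinsic_mean W C o t.
Proof.
by rewrite (expect_erased_mean t (fun x => x ^+ 2)) expect_posterior_mean_sqr.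
Qed.

Lemma separation_splice_corr b : b o = false -> (forall u, u \in C1 -> b * u \in C) ->
  separation W * (extrinsic_mean W C o t -
    splice_corr q (zero_set b) erased_mean erased_mean) <=
  2 * info_gap.
Proof.
move=> b_o b_mul; set f := erased_mean.
pose f0 y := f (graph_restr 0 y); pose fb y := f (graph_restr b y).
have -> : extrinsic_mean W C o t - splice_corr q (zero_set b) f f =
    2^-1 * expect Q (fun y => (f0 y - fb y) ^+ 2).
  transitivity (2^-1 * (expect Q (fun y => f0 y ^+ 2) + expect Q (fun y => fb y ^+ 2) -
      2 * expect Q (fun y => f0 y * fb y))); last first.
    by rewrite -expectZ -expectD -expectB; congr (_ * _); apply: eq_expect => y; ring.
  rewrite (expect_graph_restr zero_o t01 (fun y => f y ^+ 2)).
  rewrite (expect_graph_restr b_o t01 (fun y => f y ^+ 2)).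
  by rewrite expect_graph_restr_mul // -/q mean_erased_sqr; field.
have near0 := separation_graph_restr zero_o zero_mul t01.
have nearb := separation_graph_restr b_o b_mul t01.
set X := expect _ _ in near0; set Y := expect _ _ in nearb.
have : expect Q (fun y => (f0 y - fb y) ^+ 2) <= 2 * (X + Y).
  rewrite /X /Y -expectD -expectZ; apply: ler_expect => // y.
  rewrite -/f -/(f0 y) -/(fb y); set x := posterior_mean _ _ _.
  by have := sqr_ge0 (x - f0 y + (x - fb y)); nra.
move=> /(ler_wpM2l (separation_ge0 W)); rewrite mulrCA -/info_gap in near0 nearb *; lra.
Qed.

End AtTime.

Lemma code_lr_plotkin (y : {ffun J * bool -> W}) :
  code_lr plotkin_code y <= code_lr C (graph_restr 0 y) * code_lr C (graph_restr 1 y).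
Proof.
set y0 := graph_restr 0 y; set y1 := graph_restr 1 y.
have word_lr_plotkin u v : word_lr (plotkin_word u v) y = word_lr u y0 * word_lr (u + v) y1.
  rewrite /word_lr big_pair_bool -big_split /=; apply: eq_bigr => j _.
  by rewrite !ffunE /= addbF.
rewrite /code_lr big_imset /=; last by move=> x x' _ _; exact: plotkin_word_inj.
rewrite (eq_bigl (fun x => (x.1 \in C) && (x.2 \in C1))); last first.
  by case=> u v; rewrite finset.in_setX.
under eq_bigr do rewrite word_lr_plotkin.
rewrite -(pair_big (mem C) (mem C1) (fun u v => word_lr u y0 * word_lr (u + v) y1)) /= mulr_suml.
apply: ler_sum => u uC; rewrite -mulr_sumr; apply: ler_wpM2l; first exact/ltW/word_lr_gt0.
rewrite -[leRHS](sum_code_shift C_linear _ uC).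
under eq_bigr do rewrite addrC.
rewrite big_mkcond [leRHS]big_mkcond; apply: ler_sum => v _.
case: ifP => [/(fintype.subsetP C1_sub) -> //|_]; case: ifP => // _.
exact/ltW/word_lr_gt0.
Qed.

Lemma code_info_plotkin :
  2 * code_info W C 1 - code_info W plotkin_code 1 <= ln #|C|%:R - ln #|C1|%:R.
Proof.
have t01 : 0 <= (1 : R) <= 1 by rewrite ler01 lexx.
have q_pmf (I : finType) i : pmf (@erasure_law R W I finset.set0 1 i).
  by case: (erasure_law_symmetric W finset.set0 i t01).
have : expect (erasure_law finset.set0 1)
      (fun y : {ffun J * bool -> W} => ln (code_lr plotkin_code y)) <=
    2 * expect (erasure_law finset.set0 1) (fun y : {ffun J -> W} => ln (code_lr C y)).
  pose split_ln (y0 y1 : {ffun J -> W}) := ln (code_lr C y0) + ln (code_lr C y1).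
  apply: (@le_trans _ _ (expect (erasure_law finset.set0 1)
      (fun y => split_ln (ffun_comp y (pair^~ false)) (ffun_comp y (pair^~ true))))).
    apply: ler_expect => // y; rewrite /split_ln -lnM ?posrE ?code_lr_gt0 //.
    rewrite ler_ln ?posrE ?mulr_gt0 ?code_lr_gt0 //; last exact: plotkin_code_linear.
    by have := code_lr_plotkin y; rewrite graph_restr0 graph_restr1.
  rewrite expect_pair_bool.
  have half_law (c : bool) : (fun j : J => @erasure_law R W _ finset.set0 1 (j, c)) =2
    erasure_law finset.set0 1 by move=> j z; rewrite /erasure_law !inE.
  rewrite (eq_expect_law _ (half_law false)).
  under eq_expect do rewrite (eq_expect_law _ (half_law true)) expectD expect_cst //.
  by rewrite expectD expect_cst //; lra.
rewrite /code_info card_plotkin_code natrM lnM ?posrE ?card_code_gt0 //; lra.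
Qed.

(* The function [2 * code_info C - code_info plotkin_code] vanishes at 0, is
   nondecreasing, and is at most [ln #|C| - ln #|C1|] at 1. *)
Lemma extrinsic_info_gap (eta : R) : 0 < eta -> eta < 1 ->
  exists t, [/\ 1 - eta < t, t < 1 &
    2 * #|J|%:R * eta * (extrinsic_info W C o t - extrinsic_info W plotkin_code (o, false) t)
    <= ln #|C|%:R - ln #|C1|%:R].
Proof.
move=> eta0 eta1; have e0 : 0 < 1 - eta by rewrite subr_gt0.
have e1 : 1 - eta < 1 by rewrite gtrBl.
pose D t := 2 * code_info W C t - code_info W plotkin_code t.
pose dD t := 2 * #|J|%:R *
  (extrinsic_info W C o t - extrinsic_info W plotkin_code (o, false) t).
have D_dD (t : R) : is_derive t 1 D (dD t).
  apply: (is_derive_eq (is_deriveB (is_deriveZ 2 (is_derive_code_info W C_linear t))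
    (is_derive_code_info W plotkin_code_linear t))).
  rewrite (@sum_extrinsic_info _ W _ C o); last first.
    by move=> j; have [h [Ch _ ho]] := transitive j; exists h.
  rewrite (@sum_extrinsic_info _ W _ plotkin_code (o, false)); last exact: plotkin_code_transitive.
  by rewrite card_prod card_bool natrM /dD -[_ *: _]/(_ * _); ring.
have D_ge0 : 0 <= D (1 - eta).
  have [c [c0 c1 increment]] := is_derive_MVT e0 D_dD.
  have -> : D (1 - eta) = dD c * (1 - eta - 0).
    by rewrite -increment /D !code_info0 ?mulr0 ?subr0 //; exact: plotkin_code_linear.
  rewrite subr0 mulr_ge0 ?(ltW e0) // mulr_ge0 //.
  by apply: extrinsic_info_plotkin_le; rewrite (ltW c0) (le_trans (ltW c1)) // ltW.
have [t [t0 t1 increment]] := is_derive_MVT e1 D_dD.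
exists t; split=> //; apply: le_trans code_info_plotkin; rewrite -/(D 1).
by have := increment; rewrite /dD; lra.
Qed.

Section Threshold.
Variable A : finType.
Variable chi : A -> {ffun J -> bool}.
Hypothesis chi_o : forall a, chi a o = false.
Hypothesis chi_mul : forall a u, u \in C1 -> chi a * u \in C.
Hypothesis A_gt0 : (0 < #|A|)%N.
Hypothesis chi_half : forall j, j != o -> (2 * #|[set a | ~~ chi a j]| <= #|A|)%N.

(* As [E f = E f^2], the left-hand side contains the variance of the estimate [f]. *)
Lemma extrinsic_mean_variance t : 0 <= t <= 1 ->
  separation W * (extrinsic_mean W C o t * (1 - extrinsic_mean W C o t)) <=
  4 * (extrinsic_info W C o t - extrinsic_info W plotkin_code (o, false) t).
Proof.
move=> t01; set mu := extrinsic_mean W C o t; set gap := _ - extrinsic_info _ _ _ _.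
pose q : J -> W -> R := erasure_law [set o] t.
have q_pmf i : pmf (q i) by case: (erasure_law_symmetric W [set o] i t01).
pose corr a := splice_corr q (zero_set (chi a)) erased_mean erased_mean.
have corr_ge a : separation W * (mu - corr a) <= 2 * gap.
  exact: (separation_splice_corr t01 (chi_o a) (@chi_mul a)).
have sum_corr_le : \sum_a corr a <= #|A|%:R * (mu ^+ 2 + 2^-1 * (mu - mu ^+ 2)).
  have <- : expect q erased_mean = mu := expect_erased_mean t id.
  have {2}<- : expect q (fun y => erased_mean y ^+ 2) = expect q erased_mean.
    rewrite (expect_erased_mean t (fun x => x ^+ 2)) (expect_erased_mean t id).
    by rewrite expect_posterior_mean_sqr // => i; exact: erasure_law_symmetric.
  apply: (sum_splice_corr_le q_pmf) => j; have [->|/chi_half half] := eqVneq j o.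
    by left => y z; rewrite /erased_mean /erase ffun_upd_upd.
  right; rewrite mulrC ler_pdivlMr // -natrM ler_nat mulnC; apply: leq_trans half.
  by rewrite leq_mul2l /=; apply: subset_leq_card; apply/fintype.subsetP => a; rewrite !inE.
have {corr_ge} sum_corr_ge : separation W * (#|A|%:R * mu - \sum_a corr a) <= #|A|%:R * (2 * gap).
  rewrite ![#|A|%:R * _]mulr_natl -!sumr_const -sumrB mulr_sumr.
  by apply: ler_sum => a _; exact: corr_ge.
have A0 : 0 < #|A|%:R :> R by rewrite ltr0n.
rewrite -(ler_pM2l A0); have := ler_wpM2l (separation_ge0 W) sum_corr_le; lra.
Qed.

Lemma extrinsic_mean_threshold (eta theta : R) : 0 < eta -> eta < 1 -> 0 < theta ->
  ln #|C|%:R < #|J|%:R * ((1 - eta) * (mixture_div W 0 - theta)) ->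
  separation W * (eta * theta * #|J|%:R) * (1 - extrinsic_mean W C o 1) <=
  2 * (ln #|C|%:R - ln #|C1|%:R).
Proof.
move=> eta0 eta1 theta0 rate_lt.
have [t [t_gt t1 gap_le]] := extrinsic_info_gap eta0 eta1.
have t0 : 0 < t by apply: lt_trans t_gt; rewrite subr_gt0.
have t01 : 0 <= t <= 1 by rewrite !ltW.
have lnC_ge0 : 0 <= ln #|C|%:R :> R by rewrite ln_ge0 // ler1n -(ltr0n R) card_code_gt0.
have mean_gt : theta < extrinsic_mean W C o t.
  apply: extrinsic_mean_gt => //; last 1 first.
  - apply: (lt_le_trans rate_lt); apply: ler_wpM2l => //; apply: ler_wpM2r; last exact: ltW.
    have := le_lt_trans lnC_ge0 rate_lt; rewrite mulrA pmulr_rgt0; first exact: ltW.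
    by rewrite mulr_gt0 ?subr_gt0 // ltr0n; apply/card_gt0P; exists o.
  - by move=> j; have [h [Ch _ ho]] := transitive j; exists h.
  - exact: ltW.
have variance := extrinsic_mean_variance t01.
have mean_le : extrinsic_mean W C o t <= extrinsic_mean W C o 1.
  by apply: extrinsic_mean_nondecreasing => //; exact: ltW.
have mean_le1 : extrinsic_mean W C o 1 <= 1.
  by apply: extrinsic_mean_le1; rewrite // ler01 lexx.
have product_le : theta * (1 - extrinsic_mean W C o 1) <=
    extrinsic_mean W C o t * (1 - extrinsic_mean W C o t).
  by apply: ler_pM; rewrite ?subr_ge0 ?lerD2l ?lerN2 // ltW.
have etaJ : 0 <= eta * #|J|%:R by rewrite mulr_ge0 // ltW.
have := ler_wpM2l etaJ (le_trans (ler_wpM2l (separation_ge0 W) product_le) variance); lra.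
Qed.

End Threshold.
End Plotkin.

(** * Reed-Muller codes *)

Lemma bit_inj n k k' : (k < 2 ^ n)%N -> (k' < 2 ^ n)%N ->
  (forall j, (j < n)%N -> bit k j = bit k' j) -> k = k'.
Proof.
elim: n k k' => [|n IHn] k k'; first by rewrite expn0 !ltnS !leqn0 => /eqP -> /eqP ->.
rewrite expnS => kn k'n bitE.
have oddE : odd k = odd k' by have := bitE 0%N isT; rewrite /bit expn0 !divn1.
rewrite -(odd_double_half k) -(odd_double_half k') oddE; congr (_ + _.*2)%N.
apply: IHn; rewrite -?divn2 ?ltn_divLR // 1?mulnC // => j jn.
by have := bitE j.+1 jn; rewrite /bit -!divnMA -expnS.
Qed.

(* [bool] carries its ring structure of the field with two elements. *)
Section ReedMuller.
Variable m : nat.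
Local Notation N := (2 ^ m)%N.
Local Notation word := {ffun 'I_N -> bool}.
Implicit Types (S : {set 'I_m}) (k : 'I_N) (j : 'I_m) (d : nat) (u : word).

Definition bits k : {ffun 'I_m -> bool} := [ffun j : 'I_m => bit k j].

Lemma bits_inj : injective bits.
Proof.
move=> k k' /ffunP bitsE; apply/val_inj/(bit_inj (ltn_ord k) (ltn_ord k')) => j jm.
by have := bitsE (Ordinal jm); rewrite !ffunE.
Qed.

Lemma bits_surj (v : {ffun 'I_m -> bool}) : exists k, forall j, bit k j = v j.
Proof.
have [|unbits _ unbitsK] := inj_card_bij bits_inj.
  by rewrite card_ffun card_bool !card_ord.
by exists (unbits v) => j; have /ffunP/(_ j) := unbitsK v; rewrite ffunE.
Qed.

Lemma exp2_gt0 : (0 < 2 ^ m)%N. Proof. by rewrite expn_gt0. Qed.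

Definition origin : 'I_N := Ordinal exp2_gt0.

Lemma bit_origin j : bit origin j = false.
Proof. by rewrite /bit div0n. Qed.

Definition coordinate j : word := [ffun k : 'I_N => bit k j].

Definition monomial S : word := [ffun k : 'I_N => \prod_(j in S) bit k j].

Definition poly_eval (c : {ffun {set 'I_m} -> bool}) : word := \sum_(S | c S) monomial S.

Definition degree_lt d : {set {ffun {set 'I_m} -> bool}} :=
  [set c : {ffun {set 'I_m} -> bool} | [forall S : {set 'I_m}, c S ==> (#|S| < d)%N]].

(* The strict degree bound makes room for the zero code [d = 0]. *)
Definition RMlt d : {set word} := poly_eval @: degree_lt d.

Lemma RM_RMlt r : RM r m = RMlt r.+1.
Proof.
have evalE c k : poly_eval c k =
    \big[addb/false]_(S : {set 'I_m}) (c S && [forall j in S, bit k j]).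
  rewrite sum_ffunE big_mkcond; apply: eq_bigr => S _; rewrite ffunE -big_andE.
  by case: (c S).
apply/setP => u; rewrite inE; apply/existsP/imsetP => [[c /andP[/forallP c_lt /forallP uE]]|[c]].
  exists c; first by rewrite inE; apply/forallP => S; rewrite ltnS -implybNN -ltnNge.
  by apply/ffunP => k; rewrite evalE; exact/eqP.
rewrite inE => /forallP c_lt ->; exists c; apply/andP; split; apply/forallP.
  by move=> S; rewrite ltnNge implybNN -ltnS.
by move=> k; rewrite evalE.
Qed.

Lemma poly_evalB c c' : poly_eval (c - c') = poly_eval c - poly_eval c'.
Proof.
apply/ffunP => k; rewrite !ffunE !sum_ffunE big_mkcond [in RHS]big_mkcond.
rewrite [X in _ = _ - X]big_mkcond -sumrB; apply: eq_bigr => S _; rewrite !ffunE.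
by case: (c S); case: (c' S); rewrite ?subr0 ?sub0r ?subrr.
Qed.

Lemma RMlt_linear d : zmod_closed (RMlt d).
Proof.
split.
  apply/imsetP; exists 0; last by rewrite /poly_eval big1 // => S; rewrite ffunE.
  by rewrite inE; apply/forallP => S; rewrite ffunE.
move=> _ _ /imsetP[c + ->] /imsetP[c' + ->]; rewrite !inE => /forallP c_lt /forallP c'_lt.
apply/imsetP; exists (c - c'); last by rewrite poly_evalB.
rewrite inE; apply/forallP => S; have := c_lt S; have := c'_lt S; rewrite !ffunE.
by case: (c S); case: (c' S).
Qed.

Lemma RMltD d u v : u \in RMlt d -> v \in RMlt d -> u + v \in RMlt d.
Proof. exact: (GRing.zmod_closedD (RMlt_linear d)).2. Qed.

Lemma RMlt_sum d (A : Type) (r : seq A) (P : pred A) (f : A -> word) :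
  (forall a, P a -> f a \in RMlt d) -> \sum_(a <- r | P a) f a \in RMlt d.
Proof.
move=> f_RM; have [RM0 _] := RMlt_linear d.
by apply: (big_ind (fun u => u \in RMlt d)) => // u v; exact: RMltD.
Qed.

Lemma RMlt_mono d d' : (d <= d')%N -> RMlt d \subset RMlt d'.
Proof.
move=> dd'; apply: imsetS; apply/fintype.subsetP => c; rewrite !inE => /forallP c_lt.
by apply/forallP => S; apply/implyP => /(implyP (c_lt S)) /leq_trans; apply.
Qed.

Lemma monomial_RMlt S d : (#|S| < d)%N -> monomial S \in RMlt d.
Proof.
move=> Sd; apply/imsetP; exists [ffun S' => S' == S].
  by rewrite inE; apply/forallP => S'; rewrite ffunE; apply/implyP => /eqP ->.
by rewrite /poly_eval (eq_bigl (pred1 S)) ?big_pred1_eq // => S'; rewrite ffunE.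
Qed.

Lemma RMlt_stable (f : word -> word) d d' : {morph f : u v / u + v} ->
  (forall S, (#|S| < d)%N -> f (monomial S) \in RMlt d') ->
  forall u, u \in RMlt d -> f u \in RMlt d'.
Proof.
move=> fD f_monomial _ /imsetP[c + ->]; rewrite inE => /forallP c_lt.
have f0 : f 0 = 0 by apply: (@addrI _ (f 0)); rewrite -fD !addr0.
rewrite /poly_eval (big_morph f fD f0); apply: RMlt_sum => S cS.
exact/f_monomial/(implyP (c_lt S)).
Qed.

Lemma RMlt_mul_coordinate d j u : u \in RMlt d -> coordinate j * u \in RMlt d.+1.
Proof.
apply: (RMlt_stable (f := *%R (coordinate j))) => [v w|S Sd]; first exact: mulrDr.
have -> : coordinate j * monomial S = monomial (j |: S).
  apply/ffunP => k; rewrite !ffunE; have [jS|jS] := boolP (j \in S).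
    rewrite (finset.setUidPr _) ?finset.sub1set // (bigD1 j) //=.
    by case: (bit k j); rewrite ?mul1r ?mul0r.
  by rewrite big_setU1.
by apply: monomial_RMlt; rewrite cardsU1 ltnS; case: (j \notin S); rewrite // ltnW.
Qed.

Lemma RMlt_prod_affine (b : 'I_m -> bool) (s : seq 'I_m) :
  [ffun k : 'I_N => \prod_(j <- s) (bit k j + b j)] \in RMlt (size s).+1.
Proof.
elim: s => [|j s IHs] /=.
  rewrite (_ : [ffun k => _] = monomial finset.set0); first by rewrite monomial_RMlt ?cards0.
  by apply/ffunP => k; rewrite !ffunE big_nil big_set0.
set v := [ffun k => _] in IHs.
rewrite (_ : [ffun k => _] = coordinate j * v + if b j then v else 0).
  apply: RMltD; first exact: RMlt_mul_coordinate.
  case: (b j); first exact: fintype.subsetP (RMlt_mono (leqnSn _)) _ IHs.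
  by case: (RMlt_linear (size s).+2).
apply/ffunP => k; rewrite !ffunE big_cons mulrDl; congr (_ + _).
by case: (b j); rewrite ffunE ?mul1r ?mul0r.
Qed.

Lemma RMlt_translation (v : 'I_N) :
  exists2 h, forall d, automorphism (RMlt d) h & h origin = v.
Proof.
have /fin_all_exists[h hE] k := bits_surj [ffun j : 'I_m => bit k j + bit v j].
have {}hE k j : bit (h k) j = bit k j + bit v j by rewrite hE ffunE.
exists h => [d|]; last first.
  by apply: bits_inj; apply/ffunP => j; rewrite !ffunE hE bit_origin add0r.
split.
  move=> k k' hk; apply: bits_inj; apply/ffunP => j; rewrite !ffunE.
  by apply: (@addIr _ (bit v j)); rewrite -!hE hk.
apply: (RMlt_stable (f := fun u => ffun_comp u h)) => [u w|S Sd].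
  by apply/ffunP => k; rewrite !ffunE.
have := RMlt_prod_affine (fun j => bit v j) (enum S).
rewrite -cardE => /(fintype.subsetP (RMlt_mono Sd)).
rewrite (_ : ffun_comp _ _ = [ffun k : 'I_N => \prod_(j <- enum S) (bit k j + bit v j)]) //.
by apply/ffunP => k; rewrite !ffunE big_enum /=; apply: eq_bigr => j _; exact: hE.
Qed.

Definition linear_form (a : {set 'I_m}) : word := \sum_(j in a) coordinate j.

Lemma RMlt_mul_linear_form d a u : u \in RMlt d -> linear_form a * u \in RMlt d.+1.
Proof.
by move=> ud; rewrite mulr_suml; apply: RMlt_sum => j _; exact: RMlt_mul_coordinate.
Qed.

Lemma linear_form_origin a : linear_form a origin = false.
Proof.
by rewrite sum_ffunE big1 // => j _; rewrite ffunE bit_origin.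
Qed.

Lemma card_linear_form_eq0 k : k != origin ->
  (2 * #|[set a | ~~ linear_form a k]| <= #|{set 'I_m}|)%N.
Proof.
move=> k0; have [j kj] : exists j, bit k j.
  apply/existsP; apply: contraNT k0 => /existsPn kE.
  apply/eqP/bits_inj/ffunP => j; rewrite !ffunE bit_origin; exact/negbTE/kE.
pose toggle (a : {set 'I_m}) := if j \in a then a :\ j else j |: a.
have toggleK : involutive toggle.
  move=> a; rewrite /toggle; case: (boolP (j \in a)) => ja.
    by rewrite finset.setD11 finset.setD1K.
  by rewrite finset.setU11 finset.setU1K.
have linear_form_toggle a : linear_form (toggle a) k = ~~ linear_form a k.
  rewrite !sum_ffunE /toggle; case: (boolP (j \in a)) => ja.
    by rewrite [in RHS](big_setD1 j ja) /= ffunE kj negbK.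
  by rewrite big_setU1 //= ffunE kj.
rewrite mul2n -addnn -[leqRHS]cardsT -(cardsID [set a | ~~ linear_form a k] [set: {set 'I_m}]).
rewrite finset.setTI leq_add2l -(card_imset _ (inv_inj toggleK)).
apply: subset_leq_card; apply/fintype.subsetP => _ /imsetP[a + ->].
by rewrite !inE linear_form_toggle => ->.
Qed.

Lemma poly_eval_inj : injective poly_eval.
Proof.
have kernel0 c : poly_eval c = 0 -> c = 0.
  move=> /ffunP c0; apply/ffunP => S0; rewrite [RHS]ffunE; apply/negbTE/negP => cS0.
  case: (arg_minnP (fun S : {set 'I_m} => #|S|) cS0) => S cS S_min.
  have [k kE] := bits_surj [ffun j => j \in S].
  have := c0 k; rewrite sum_ffunE (bigD1 S) //= big1 => [|S' /andP[cS' S'S]].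
    by rewrite addr0 !ffunE big1 // => j jS; rewrite kE ffunE jS.
  rewrite ffunE; have /fintype.subsetPn[j jS' jS] : ~~ (S' \subset S).
    by apply: contraNN S'S => S'S; rewrite eqEcard S'S S_min.
  by rewrite (bigD1 j) //= kE ffunE (negPf jS) mul0r.
by move=> c c' cc'; apply/subr0_eq/kernel0; rewrite poly_evalB cc' subrr.
Qed.

Lemma card_RMlt d : #|RMlt d| = (2 ^ (\sum_(i < d) 'C(m, i)))%N.
Proof.
rewrite card_imset; last exact: poly_eval_inj.
have -> : #|degree_lt d| = #|pffun_on false [set S : {set 'I_m} | #|S| < d]%N xpredT|.
  apply: eq_card => c; rewrite inE; apply/forallP/pffun_onP => [c_lt|[/fintype.subsetP c_supp _] S].
    split=> //; apply/fintype.subsetP => S; rewrite !inE => cS.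
    by apply: (implyP (c_lt S)); case: (c S) cS.
  by apply/implyP => cS; have := c_supp S; rewrite !inE => -> //; rewrite cS.
rewrite card_pffun_on card_bool; congr (_ ^ _)%N; elim: d => [|d IHd].
  by rewrite big_ord0; apply/eqP; rewrite cards_eq0; apply/eqP/setP => S; rewrite !inE.
rewrite big_ord_recr /= -IHd -[X in 'C(X, d)]card_ord -card_draws -cardsUI.
rewrite [X in (_ + X)%N](_ : _ = 0)%N ?addn0.
  by congr #|pred_of_set _|; apply/setP => S; rewrite !inE ltnS leq_eqVlt orbC.
by apply/eqP; rewrite cards_eq0; apply/eqP/setP => S; rewrite !inE; case: ltngtP.
Qed.

End ReedMuller.

Lemma central_bin_le n : ('C(n.*2, n) ^ 2 * n.*2.+1 <= 16 ^ n)%N.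
Proof.
elim: n => [|n IHn]; first by rewrite bin0.
have central_binS : (n.+1 * 'C(n.+1.*2, n.+1) = 2 * n.*2.+1 * 'C(n.*2, n))%N.
  have diag2 := mul_bin_diag n.+1.*2 n; have diag1 := mul_bin_diag n.*2.+1 n.
  have sym : 'C(n.*2.+1, n) = 'C(n.*2.+1, n.+1).
    by rewrite -[RHS]bin_sub ?ltnS -?addnn ?leq_addr // subSS addnK.
  rewrite doubleS /= sym in diag2; rewrite /= in diag1; rewrite doubleS -diag2.
  by rewrite -doubleS -mul2n -!mulnA diag1.
set x := 'C(_, _) in central_binS *; set y := 'C(_, _) in IHn central_binS.
rewrite -(leq_pmul2l (ltn0Sn n)) -(leq_pmul2l (ltn0Sn n)).
have -> : (n.+1 * (n.+1 * (x ^ 2 * n.+1.*2.+1)) =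
    4 * n.*2.+1 * n.+1.*2.+1 * (y ^ 2 * n.*2.+1))%N.
  transitivity ((n.+1 * x) ^ 2 * n.+1.*2.+1)%N; first by lia.
  by rewrite central_binS; lia.
apply: leq_trans (leq_mul (leqnn _) IHn) _.
rewrite [(16 ^ n.+1)%N]expnS !mulnA leq_mul2r; apply/orP; right; lia.
Qed.

Lemma bin_pow4_le m r : (r <= m)%N -> ('C(m, r) ^ 4 * m.*2.+1 <= 16 ^ m)%N.
Proof.
move=> rm; apply: leq_trans (central_bin_le m); rewrite leq_mul2r; apply/orP; right.
rewrite (expnM _ 2 2) leq_exp2r // -addnn -binomial.Vandermonde.
rewrite (bigD1 (Ordinal (rm : (r < m.+1)%N))) //= bin_sub // mulnn.
exact: leq_addr.
Qed.

Lemma bin_density_lt (R : realType) (d : R) : 0 < d ->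
  exists M, forall m r, (M <= m)%N -> (r <= m)%N -> 'C(m, r)%:R / (2 ^ m)%:R < d.
Proof.
move=> d0; have d4 : 0 < d ^+ 4 by rewrite exprn_gt0.
exists (Num.truncn (d ^+ 4)^-1) => m r Mm rm.
have pow0 : 0 < (2 ^ m)%:R :> R by rewrite ltr0n expn_gt0.
have big_m : (d ^+ 4)^-1 < m.*2.+1%:R.
  apply: lt_le_trans (truncnS_gt _) _; rewrite ler_nat ltnS.
  by apply: leq_trans Mm _; rewrite -addnn leq_addr.
rewrite ltNge; apply/negP; rewrite ler_pdivlMr // => d_le.
have d4_le : d ^+ 4 * (2 ^ m)%:R ^+ 4 <= 'C(m, r)%:R ^+ 4.
  by rewrite -exprMn lerXn2r ?nnegrE // mulr_ge0 // ltW.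
have m1 : 0 < m.*2.+1%:R :> R by rewrite ltr0n.
have := bin_pow4_le rm; rewrite (_ : 16 ^ m = (2 ^ m) ^ 4)%N; last by rewrite -expnM mulnC expnM.
rewrite -(ler_nat R) natrM !natrX => /(le_trans (ler_wpM2r (ltW m1) d4_le)).
rewrite natrX mulrAC ger_pMl ?exprn_gt0 // leNgt => /negP; apply.
by rewrite -ltr_pdivrMl // mulr1.
Qed.

Lemma RM_extrinsic_mean (R : realType) (W : symmetric_channel R) r m (i : 'I_(2 ^ m))
    (eta theta : R) :
  0 < eta -> eta < 1 -> 0 < theta ->
  rate R r m * ln 2 < (1 - eta) * (mixture_div W 0 - theta) ->
  separation W * (eta * theta) * (1 - extrinsic_mean W (RM r m) i 1) <=
  2 * ln 2 * ('C(m, r)%:R / (2 ^ m)%:R).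
Proof.
move=> eta0 eta1 theta0 rate_lt; rewrite RM_RMlt.
have N0 : 0 < (2 ^ m)%:R :> R by rewrite ltr0n expn_gt0.
have [h h_aut <-] := RMlt_translation i; rewrite extrinsic_mean_comp //.
have ln_card d : ln #|RMlt m d|%:R = (\sum_(j < d) 'C(m, j))%:R * ln 2 :> R.
  by rewrite card_RMlt natrX lnXn // mulr_natl.
have threshold : separation W * (eta * theta * (2 ^ m)%:R) *
      (1 - extrinsic_mean W (RMlt m r.+1) (origin m) 1) <=
    2 * ((\sum_(j < r.+1) 'C(m, j))%:R * ln 2 - (\sum_(j < r) 'C(m, j))%:R * ln 2).
  rewrite -!ln_card -[in (2 ^ m)%:R](card_ord (2 ^ m)).
  apply: (@extrinsic_mean_threshold _ W _ _ _ _ _ _ _ _ _ (@linear_form m)) => //.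
  - exact: RMlt_linear.
  - exact: RMlt_linear.
  - exact: RMlt_mono.
  - by move=> v; have [h' h'_aut <-] := RMlt_translation v; exists h'.
  - exact: linear_form_origin.
  - by move=> a u; exact: RMlt_mul_linear_form.
  - by apply/card_gt0P; exists finset.set0.
  - by move=> v; exact: card_linear_form_eq0.
  - by rewrite ln_card card_ord -ltr_pdivrMl // mulrA [_^-1 * _]mulrC.
rewrite -mulrBl big_ord_recr /= natrD addrAC subrr add0r in threshold.
rewrite -(ler_pM2r N0) [leRHS](_ : _ = 2 * ('C(m, r)%:R * ln 2)); last first.
  by field; rewrite lt0r_neq0.
lra.
Qed.

(** * Lower integrals and the decoding error *)

Section LowerIntegral.
Context d (X : measurableType d) (R : realType) (nu : {measure set X -> \bar R}).
Local Open Scope ereal_scope.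
Import HBNNSimple.
Implicit Types f g : X -> \bar R.

(* The integral of a nonnegative function is the supremum of the integrals of
   the simple functions below it, so that monotonicity and superadditivity hold
   without any measurability assumption. *)
Lemma lower_integral_mono f g : (forall x, 0 <= f x) -> (forall x, f x <= g x) ->
  \int[nu]_x f x <= \int[nu]_x g x.
Proof.
move=> f0 fg; have g0 x : 0 <= g x by exact: le_trans (f0 x) (fg x).
rewrite !ge0_integralTE //; apply: ge_ereal_sup => _ [h /= hf <-].
by apply: ereal_sup_ubound; exists h => //= x; exact: le_trans (hf x) (fg x).
Qed.

Lemma lower_integral_superadditive f g : (forall x, 0 <= f x) -> (forall x, 0 <= g x) ->
  \int[nu]_x f x + \int[nu]_x g x <= \int[nu]_x (f x + g x).
Proof.
move=> f0 g0; have fg0 x : 0 <= f x + g x by rewrite adde_ge0.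
have [->|] := eqVneq (\int[nu]_x (f x + g x)) +oo; first exact: leey.
rewrite -ltey => fg_fin.
have f_fin : \int[nu]_x f x \is a fin_num.
  rewrite ge0_fin_numE ?integral_ge0 //; apply: le_lt_trans fg_fin.
  by apply: lower_integral_mono => // x; rewrite leeDl.
have g_fin : \int[nu]_x g x \is a fin_num.
  rewrite ge0_fin_numE ?integral_ge0 //; apply: le_lt_trans fg_fin.
  by apply: lower_integral_mono => // x; rewrite leeDr.
apply/lee_addgt0Pr => e e0; have e2 : (0 < e / 2)%R by rewrite divr_gt0.
rewrite ge0_integralTE // in f_fin *; rewrite ge0_integralTE // in g_fin *.
have [_ [h hf <-]] := ub_ereal_sup_adherent e2 f_fin.
have [_ [k kg <-]] := ub_ereal_sup_adherent e2 g_fin.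
rewrite !lteBlDr // => k_near h_near.
apply: le_trans (leeD (ltW h_near) (ltW k_near)) _.
rewrite addeACA -EFinD -splitr; apply: leeD2r; rewrite ge0_integralTE // -sintegralD.
apply: ereal_sup_ubound; exists (h \+ k)%R => //= x.
by rewrite EFinD; apply: leeD; [exact: hf | exact: kg].
Qed.

End LowerIntegral.

Section IteratedIntegral.
Variables (R : realType) (nu : {measure set (\bar R) -> \bar R}).
Local Open Scope ereal_scope.
Implicit Types F G : seq (\bar R) -> \bar R.

Lemma iint_ge0 n F : (forall y, 0 <= F y) -> 0 <= iint nu n F.
Proof.
elim: n F => [|n IHn] F F0 //=.
by apply: integral_ge0 => y _; exact: IHn.
Qed.

Lemma iint_mono n F G : (forall y, 0 <= F y) -> (forall y, F y <= G y) ->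
  iint nu n F <= iint nu n G.
Proof.
elim: n F G => [|n IHn] F G F0 FG //=.
by apply: lower_integral_mono => y; [exact: iint_ge0 | exact: IHn].
Qed.

Lemma iint_superadditive n F G : (forall y, 0 <= F y) -> (forall y, 0 <= G y) ->
  iint nu n F + iint nu n G <= iint nu n (fun y => F y + G y).
Proof.
elim: n F G => [|n IHn] F G F0 G0 //=.
apply: le_trans (lower_integral_superadditive _ _ _) _ => [y|y|].
- exact: iint_ge0.
- exact: iint_ge0.
by apply: lower_integral_mono => y; [apply: adde_ge0; exact: iint_ge0 | exact: IHn].
Qed.

Lemma sum_iint_le n (A : Type) (r : seq A) (P : pred A) (F : A -> seq (\bar R) -> \bar R) :
  (forall a y, 0 <= F a y) ->
  \sum_(a <- r | P a) iint nu n (F a) <= iint nu n (fun y => \sum_(a <- r | P a) F a y).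
Proof.
move=> F0; elim: r => [|a r IHr].
  by rewrite big_nil; apply: iint_ge0 => y; rewrite big_nil.
have sum_ge0 y : 0 <= \sum_(a <- r | P a) F a y by apply: sume_ge0.
rewrite big_cons; case: ifP => Pa.
  apply: le_trans (leeD2l _ IHr) _; apply: le_trans (iint_superadditive _ (F0 a) sum_ge0) _.
  by apply: iint_mono => y; [rewrite adde_ge0 | rewrite big_cons Pa].
by apply: le_trans IHr _; apply: iint_mono => y //; rewrite big_cons Pa.
Qed.

Lemma iint_sum_prod n (A : Type) (r : seq A) (c : A -> R) (h : A -> 'I_n -> \bar R -> R)
    (v : A -> 'I_n -> R) :
  (forall a, 0 <= c a)%R -> (forall a j y, 0 <= h a j y)%R ->
  (forall a j, measurable_fun setT (h a j)) ->
  (forall a j, \int[nu]_y (h a j y)%:E = (v a j)%:E) ->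
  iint nu n (fun y => (\sum_(a <- r) c a * \prod_(j < n) h a j (nth 0 y j))%:E) =
  (\sum_(a <- r) c a * \prod_(j < n) v a j)%:E.
Proof.
elim: n c h v => [|n IHn] c h v c0 h0 mh hv /=.
  by congr EFin; apply: eq_bigr => a _; rewrite !big_ord0.
have v0 a j : (0 <= v a j)%R.
  by rewrite -lee_fin -hv; apply: integral_ge0 => y _; rewrite lee_fin.
under eq_integral => y _.
  under [X in iint _ _ X]eq_fun => s.
    under eq_bigr do rewrite big_ord_recl /= mulrA.
    over.
  rewrite (IHn (fun a => c a * h a ord0 y)%R (fun a j => h a (lift ord0 j))
    (fun a j => v a (lift ord0 j))) //; last by move=> a; rewrite mulr_ge0.
  rewrite -sumEFin.
  under eq_bigr do rewrite mulrAC EFinM.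
  over.
rewrite ge0_integral_sum //.
- rewrite -sumEFin; apply: eq_bigr => a _.
  rewrite ge0_integralZl_EFin //.
  + by rewrite hv -EFinM big_ord_recl mulrA mulrAC.
  + by move=> y _; rewrite lee_fin.
  + exact/measurable_EFinP.
  + by rewrite mulr_ge0 // prodr_ge0.
- by move=> a; apply: measurable_funeM; exact/measurable_EFinP.
- by move=> a y _; rewrite -EFinM lee_fin !mulr_ge0 // prodr_ge0.
Qed.

End IteratedIntegral.

Section BitMAP.
Variables (R : realType) (w : \bar R -> R).
Hypothesis w_ge0 : forall y, 0 <= w y.
Variables (N : nat) (C : {set {ffun 'I_N -> bool}}) (i : 'I_N) (y : seq (\bar R)).

Lemma chan_dens_ge0 x z : 0 <= chan_dens w x z.
Proof. by rewrite /chan_dens; case: ifP. Qed.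

Lemma lik_ge0 (u : {ffun 'I_N -> bool}) : 0 <= lik w u y.
Proof. by apply: prodr_ge0 => j _; exact: chan_dens_ge0. Qed.

Lemma bpsk_inj : injective (bpsk R).
Proof. exact: signr_inj. Qed.

Definition bit_lik (b : bool) : R := \sum_(u in C | u i == b) lik w u y.

Lemma bit_lik_ge0 b : 0 <= bit_lik b.
Proof. by apply: sumr_ge0 => u _; exact: lik_ge0. Qed.

Lemma sum_lik_by_bit (F : bool -> R) : \sum_(u in C) F (u i) * lik w u y =
  F false * bit_lik false + F true * bit_lik true.
Proof.
rewrite (bigID (fun u : {ffun 'I_N -> bool} => u i)) /= addrC !mulr_sumr.
congr (_ + _); apply: eq_big => u; rewrite ?eqb_id ?eqbF_neg // => /andP[_].
  by move=> /negPf ->.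
by move=> ->.
Qed.

Lemma sum_lik : \sum_(u in C) lik w u y = bit_lik false + bit_lik true.
Proof.
have := sum_lik_by_bit (fun=> 1); rewrite !mul1r => <-.
by apply: eq_bigr => u _; rewrite mul1r.
Qed.

Lemma posteriorE b : posterior w C i (bpsk R b) y =
  bit_lik b / (bit_lik false + bit_lik true).
Proof.
rewrite /posterior -!mulr_sumr sum_lik.
rewrite (eq_bigl (fun u => (u \in C) && (u i == b))); last first.
  by move=> u; rewrite (inj_eq bpsk_inj).
have [C0|C_neq0] := eqVneq C finset.set0; last first.
  by rewrite -mulf_div divff ?mul1r // invr_eq0 pnatr_eq0 cards_eq0.
by rewrite C0 cards0 invr0 !mul0r /bit_lik C0 big1 ?mul0r // => u; rewrite inE.
Qed.

Lemma bitMAPE : bitMAP w C i y = bpsk R (bit_lik false < bit_lik true).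
Proof.
have bpsk0 : 1 = bpsk R false by rewrite /bpsk expr0.
have bpsk1 : -1 = bpsk R true by rewrite /bpsk expr1.
have -> : bitMAP w C i y =
    if posterior w C i (bpsk R true) y <= posterior w C i (bpsk R false) y
    then bpsk R false else bpsk R true by rewrite /bitMAP -bpsk0 -bpsk1.
rewrite !posteriorE.
have := bit_lik_ge0 false; have := bit_lik_ge0 true.
set a := bit_lik false; set b := bit_lik true => b0 a0.
have [ab0|ab0] := eqVneq (a + b) 0.
  have -> : a = 0 by lra.
  have -> : b = 0 by lra.
  by rewrite !mul0r lexx ltxx.
have ab_gt0 : 0 < a + b by rewrite lt_neqAle eq_sym ab0 addr_ge0.
by rewrite ler_pM2r ?invr_gt0 // leNgt; case: (a < b).
Qed.

Lemma sum_lik_MAP_error :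
  \sum_(u in C) (bpsk R (u i) != bitMAP w C i y)%:R * lik w u y =
  Num.min (bit_lik false) (bit_lik true).
Proof.
rewrite bitMAPE minElt (sum_lik_by_bit (fun b => (bpsk R b != _)%:R)).
rewrite !(inj_eq bpsk_inj).
by case: (_ < _); rewrite /= ?mul1r ?mul0r ?addr0 ?add0r.
Qed.

(* [x] is the mean of an arbitrary randomized decision with values in {-1, 1}. *)
Lemma MAP_optimal (x : R) : `|x| <= 1 ->
  \sum_(u in C) (bpsk R (u i) != bitMAP w C i y)%:R * lik w u y <=
  \sum_(u in C) (1 - (-1) ^+ (u i) * x) / 2 * lik w u y.
Proof.
rewrite ler_norml => /andP[x1 x2]; rewrite sum_lik_MAP_error.
rewrite (sum_lik_by_bit (fun b => (1 - (-1) ^+ b * x) / 2)) expr0 expr1.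
have := bit_lik_ge0 false; have := bit_lik_ge0 true.
by case: (lerP (bit_lik false)); nra.
Qed.

End BitMAP.

Section Degradation.
Variables (R : realType) (nu : {measure set (\bar R) -> \bar R}) (w : \bar R -> R).

Definition stochastic_kernel (T : finType) (k : T -> \bar R -> R) : Prop :=
  [/\ forall c y, 0 <= k c y, forall y, \sum_c k c y = 1 &
      forall c, measurable_fun setT (k c)].

(* [P b c] is the probability that the kernel outputs [c] when the input bit is [b]. *)
Definition degradation (T : finType) (k : T -> \bar R -> R) (P : bool -> T -> R) : Prop :=
  stochastic_kernel k /\
  forall c b, (\int[nu]_y (k c y * chan_dens w (bpsk R b) y)%:E = (P b c)%:E)%E.

Hypothesis BMS : is_BMS nu w.

Let w_ge0 y : 0 <= w y. Proof. by case: BMS. Qed.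

Lemma measurable_oppe_comp (f : \bar R -> R) : measurable_fun setT f ->
  measurable_fun setT (fun y : \bar R => f (- y)%E).
Proof. by move=> mf; apply: (measurableT_comp mf); exact: oppe_measurable. Qed.

Lemma measurable_chan_dens x : measurable_fun setT (chan_dens w x).
Proof.
have [_ _ _ mw _] := BMS.
by rewrite /chan_dens; case: (x == 1); [exact: mw | exact: measurable_oppe_comp].
Qed.

Variables (T : finType) (k : T -> \bar R -> R) (P : bool -> T -> R).
Hypothesis kP : degradation k P.
Variables (N : nat) (C : {set {ffun 'I_N -> bool}}) (i : 'I_N).

Let k_ge0 c y : 0 <= k c y. Proof. by case: kP => -[]. Qed.

Lemma sum_prod_kernel (y : seq (\bar R)) :
  \sum_(c : {ffun 'I_N -> T}) \prod_j k (c j) (nth 0%E y j) = 1.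
Proof.
rewrite -(bigA_distr_bigA (fun j z => k z (nth 0%E y (j : 'I_N)))) big1 // => j _.
by case: kP => -[].
Qed.

Section RandomizedDecision.
Variable g : {ffun 'I_N -> T} -> R.
Hypothesis g_le1 : forall c, `|g c| <= 1.

(* The probability that a randomized decision of mean [g c] differs from the bit [i] of [u]. *)
Definition decision_err (u : {ffun 'I_N -> bool}) (c : {ffun 'I_N -> T}) : R :=
  (1 - (-1) ^+ (u i) * g c) / 2.

Lemma decision_err_ge0 u c : 0 <= decision_err u c.
Proof.
rewrite divr_ge0 // subr_ge0; apply: le_trans (ler_norm _) _.
by rewrite normrM normr_sign mul1r.
Qed.

Lemma MAP_error_le_decision (y : seq (\bar R)) :
  \sum_(u in C) (bpsk R (u i) != bitMAP w C i y)%:R * lik w u y <=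
  \sum_(u in C) \sum_c decision_err u c *
    \prod_j (k (c j) (nth 0%E y j) * chan_dens w (bpsk R (u j)) (nth 0%E y j)).
Proof.
pose kprod (c : {ffun 'I_N -> T}) := \prod_j k (c j) (nth 0%E y j).
have kprod_ge0 c : 0 <= kprod c by apply: prodr_ge0.
pose x := \sum_c kprod c * g c.
have x1 : `|x| <= 1.
  rewrite -(sum_prod_kernel y); apply: le_trans (ler_norm_sum _ _ _) _.
  by apply: ler_sum => c _; rewrite normrM (ger0_norm (kprod_ge0 c)) ler_piMr.
apply: le_trans (MAP_optimal w_ge0 C i y x1) _.
apply: ler_sum => u _; rewrite [leRHS](_ : _ = (1 - (-1) ^+ u i * x) / 2 * lik w u y) //.
under eq_bigr do rewrite big_split /= mulrA.
rewrite -mulr_suml; congr (_ * _); rewrite -[X in (X - _) / 2](sum_prod_kernel y).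
rewrite /x mulr_sumr -sumrB mulr_suml; apply: eq_bigr => c _.
by rewrite /decision_err -/(kprod c); field.
Qed.

Lemma bit_err_le_decision :
  (bit_err nu w C i <= (#|C|%:R^-1 * \sum_(u in C) \sum_(c : {ffun 'I_N -> T})
     decision_err u c * \prod_j P (u j) (c j))%:E)%E.
Proof.
have [[_ _ mk] kE] := kP.
have err_ge0 (u : {ffun 'I_N -> bool}) y :
    (0 <= ((bpsk R (u i) != bitMAP w C i y)%:R * lik w u y)%:E)%E.
  by rewrite lee_fin mulr_ge0 // lik_ge0.
rewrite /bit_err -ge0_sume_distrr; last by move=> u _; exact: iint_ge0.
rewrite EFinM; apply: lee_wpmul2l; first by rewrite lee_fin invr_ge0.
apply: le_trans (sum_iint_le _ _ _ _ err_ge0) _.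
pose r := [seq x <- index_enum ({ffun 'I_N -> bool} * {ffun 'I_N -> T})%type | x.1 \in C].
have sum_r (F : {ffun 'I_N -> bool} -> {ffun 'I_N -> T} -> R) :
    \sum_(u in C) \sum_c F u c = \sum_(x <- r) F x.1 x.2.
  rewrite big_filter (pair_big (mem C) xpredT) /=.
  by apply: eq_bigl => -[u c]; rewrite /= andbT.
rewrite sum_r -(iint_sum_prod (n := N) (nu := nu) r (c := fun x => decision_err x.1 x.2)
  (h := fun x j y => k (x.2 j) y * chan_dens w (bpsk R (x.1 j)) y)) //.
- apply: iint_mono => y; first by apply: sume_ge0.
  by rewrite sumEFin lee_fin; apply: le_trans (MAP_error_le_decision y) _; rewrite sum_r.
- by move=> x; exact: decision_err_ge0.
- by move=> x j y; rewrite mulr_ge0 // chan_dens_ge0.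
- by move=> x j; apply: measurable_funM; [exact: mk | exact: measurable_chan_dens].
Qed.

End RandomizedDecision.
End Degradation.

Section SymmetricDegradation.
Variables (R : realType) (nu : {measure set (\bar R) -> \bar R}) (w : \bar R -> R).
Hypothesis BMS : is_BMS nu w.
Variables (W : symmetric_channel R) (k : W -> \bar R -> R).

Definition channel_law (b : bool) (z : W) : R := law (if b then mirror z else z).

Hypothesis kW : degradation nu w k channel_law.

Lemma bit_err_le_extrinsic_mean N (C : {set {ffun 'I_N -> bool}}) (i : 'I_N) :
  zmod_closed C -> (bit_err nu w C i <= ((1 - extrinsic_mean W C i 1) / 2)%:E)%E.
Proof.
move=> C_linear; pose q (j : 'I_N) := @law R W.
have q_sym j : symmetric_law (q j) := law_symmetric W.
have q_pmf j : pmf (q j) by case: (q_sym j).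
pose g (y : {ffun 'I_N -> W}) := posterior_mean C i (erase i y).
have g_eqv : equivariant C i g by exact/erase_equivariant/posterior_mean_equivariant.
have g_le1 y : `|g y| <= 1 by exact: posterior_mean_le1.
apply: le_trans (bit_err_le_decision BMS kW C i g_le1) _.
have -> : extrinsic_mean W C i 1 = expect q g.
  rewrite (expect_erase (posterior_mean C i)) ?law_sum1 //; apply: eq_expect_law => j z.
  rewrite /erasure_law /law_upd inE; case: eqP => // _.
  by rewrite subrr mul0r add0r mul1r.
rewrite lee_fin (eq_bigr (fun=> (1 - expect q g) / 2)) => [|u uC].
  by rewrite sumr_const -[(_ / _) *+ _]mulr_natl mulKf // lt0r_neq0 // card_code_gt0.
transitivity (expect q (fun y => word_lr u y * decision_err i g u y)).
  apply: eq_bigr => y _; rewrite mulrA mulrC -big_split /=; congr (_ * _).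
  apply: eq_bigr => j _; rewrite /channel_law; case: (u j); rewrite ?mulr1 //.
  by have [_ ->] := law_symmetric W.
rewrite (expect_word_lr q_sym) -[X in X - _](expect_cst 1 q_pmf) -expectB mulrC -expectZ.
apply: eq_expect => y; rewrite /decision_err g_eqv // mulrA -expr2 sqrr_sign mul1r.
by rewrite mulrC.
Qed.

End SymmetricDegradation.

(** * Quantization of the channel output *)

Section InformationDensity.
Variables (R : realType) (w : \bar R -> R).
Hypothesis w_ge0 : forall y, 0 <= w y.

Definition info_density (y : \bar R) : R :=
  (plog2 (chan_dens w 1 y) (out_dens w y) + plog2 (chan_dens w (-1) y) (out_dens w y)) / 2.

Lemma info_densityE y : info_density y =
  (w y * ln (w y / ((w y + w (- y)%E) / 2)) +
   w (- y)%E * ln (w (- y)%E / ((w y + w (- y)%E) / 2))) / (2 * ln 2).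
Proof.
have plog2E (a p : R) : plog2 a p = a * ln (a / p) / ln 2.
  by rewrite /plog2; case: eqP => [->|_]; rewrite ?mul0r // mulrA.
have m11 : (-1 == 1 :> R) = false by apply/eqP; lra.
by rewrite /info_density /out_dens /chan_dens eqxx m11 !plog2E; field; rewrite lt0r_neq0 // ln2_gt0.
Qed.

Lemma info_density_ge0 y : 0 <= info_density y.
Proof.
rewrite info_densityE divr_ge0 ?mulr_ge0 ?(ltW (ln2_gt0 R)) //.
have := w_ge0 y; have := w_ge0 (- y)%E; set a := w y; set b := w (- y)%E => b0 a0.
have := addr_ge0 a0 b0; rewrite le_eqVlt => /predU1P[ab0|ab].
  have -> : a = 0 by lra.
  have -> : b = 0 by lra.
  by rewrite !mul0r addr0.
have p0 : 0 < (a + b) / 2 by rewrite divr_gt0.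
by have := mul_ln_ratio_ge a0 p0; have := mul_ln_ratio_ge b0 p0; lra.
Qed.

End InformationDensity.

Section Quantization.
Variables (R : realType) (nu : {measure set (\bar R) -> \bar R}) (w : \bar R -> R).
Hypothesis BMS : is_BMS nu w.
Variable n : nat.
Local Notation K := (n.+1%:R : R).
Local Notation cells := ('I_n.+1 * 'I_n.+1)%type.

Let w_ge0 y : 0 <= w y. Proof. by case: BMS. Qed.
Let mw : measurable_fun setT w. Proof. by case: BMS. Qed.
Let K0 : 0 < K. Proof. by rewrite ltr0n. Qed.

(* The posterior mean of the input given the output; 0 where both densities vanish. *)
Definition bias (y : \bar R) : R := (w y - w (- y)%E) / (w y + w (- y)%E).

Definition level (y : \bar R) : 'I_n.+1 := inord (minn n (Num.truncn (K * bias y))).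

Definition cell (y : \bar R) : cells := (level y, level (- y)%E).

Definition swap (c : cells) : cells := (c.2, c.1).

Definition cell_bias (c : cells) : R := (c.1%:R - c.2%:R) / K.

Lemma swapK : involutive swap.
Proof. by case. Qed.

Lemma cell_oppe y : cell (- y)%E = swap (cell y).
Proof. by rewrite /cell oppeK. Qed.

Lemma cell_bias_swap c : cell_bias (swap c) = - cell_bias c.
Proof. by rewrite /cell_bias -mulNr opprB. Qed.

Lemma cell_bias_bound c : 1 / K <= 1 - `|cell_bias c|.
Proof.
have level_itv (l : 'I_n.+1) : 0 <= (l%:R : R) <= n%:R by rewrite ler0n ler_nat -ltnS ltn_ord.
have /andP[c1_0 c1_n] := level_itv c.1; have /andP[c2_0 c2_n] := level_itv c.2.
rewrite normrM normfV (gtr0_norm K0) -(ler_pM2r K0) mulrBl !divfK ?lt0r_neq0 // mul1r.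
rewrite lerBrDl -lerBrDr -[K]natr1 addrK ler_norml; apply/andP; split; lra.
Qed.

Lemma cell_bias_itv c : -1 < cell_bias c < 1.
Proof.
rewrite -ltr_norml -subr_gt0; apply: lt_le_trans (cell_bias_bound c).
by rewrite divr_gt0.
Qed.

Lemma bias_oppe y : bias (- y)%E = - bias y.
Proof. by rewrite /bias oppeK [w (- y)%E + w y]addrC -mulNr opprB. Qed.

Lemma bias_le1 y : bias y <= 1.
Proof.
have := addr_ge0 (w_ge0 y) (w_ge0 (- y)%E); rewrite le_eqVlt => /predU1P[w0|w0].
  by rewrite /bias -w0 invr0 mulr0.
by rewrite ler_pdivrMr // mul1r; have := w_ge0 (- y)%E; lra.
Qed.

Lemma levelE y : level y = minn n (Num.truncn (K * bias y)) :> nat.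
Proof. by rewrite inordK // ltnS geq_minl. Qed.

Lemma level_itv y : 0 <= bias y -> K * bias y - 1 <= (level y)%:R <= K * bias y.
Proof.
move=> b0; have Kb0 : 0 <= K * bias y by rewrite mulr_ge0 // ltW.
have /andP[trunc_le trunc_gt] := truncn_itv Kb0.
rewrite -[X in _ < X]natr1 in trunc_gt; rewrite levelE /minn; case: ltnP => [n_lt|_]; last first.
  by apply/andP; split; lra.
have Kb_le : K * bias y <= K by rewrite ler_piMr ?bias_le1 // ltW.
rewrite -(ler_nat R) -[X in X <= _]natr1 in n_lt; rewrite -[X in _ <= X]natr1 in Kb_le.
by apply/andP; split; lra.
Qed.

Lemma level_eq0 y : bias y <= 0 -> (level y)%:R = 0 :> R.
Proof.
move=> b0; rewrite levelE; have /truncn0Pn -> : ~~ (1 <= K * bias y); last by rewrite minn0.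
by rewrite -ltNge; apply: le_lt_trans (ltr01); rewrite pmulr_rle0.
Qed.

Lemma cell_bias_close y : `|bias y - cell_bias (cell y)| <= 1 / K.
Proof.
rewrite -(ler_pM2l K0) -{1}(gtr0_norm K0) -normrM mulrBr mul1r mulfV ?lt0r_neq0 //.
rewrite [K * cell_bias _]mulrC divfK ?lt0r_neq0 //= ler_norml.
have [b0|/ltW b0] := lerP 0 (bias y).
  have /andP[lower upper] := level_itv b0.
  by rewrite (@level_eq0 (- y)%E) ?bias_oppe ?oppr_le0 // subr0; apply/andP; split; lra.
have := @level_itv (- y)%E; rewrite bias_oppe oppr_ge0 mulrN => /(_ b0)/andP[lower upper].
by rewrite (level_eq0 b0) sub0r opprK; apply/andP; split; lra.
Qed.

Lemma measurable_level_ge i : measurable_fun setT (fun y => (i <= level y)%N).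
Proof.
case: i => [|i]; first exact: measurable_cst.
have mopp := measurable_oppe_comp mw.
rewrite (_ : (fun y => _) = (fun y => (i < n)%N && ((0 < w y + w (- y)%E) &&
    (i.+1%:R * (w y + w (- y)%E) <= K * (w y - w (- y)%E))))).
  apply: measurable_and; first exact: measurable_cst.
  apply: measurable_and.
    by apply: measurable_fun_ltr => //; exact: measurable_funD.
  apply: measurable_fun_ler; apply: measurable_funM => //; first exact: measurable_funD.
  exact: measurable_funB.
apply/funext => y; rewrite levelE leq_min truncn_gt_nat; congr (_ && _).
have := addr_ge0 (w_ge0 y) (w_ge0 (- y)%E); rewrite le_eqVlt => /predU1P[w0|w0].
  by rewrite /bias -w0 ltxx invr0 !mulr0 lern0.
by rewrite w0 /bias mulrA ler_pdivlMr.
Qed.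

Lemma measurable_cell_eq c : measurable_fun setT (fun y => cell y == c).
Proof.
have measurable_level_eq i : measurable_fun setT (fun y => level y == i).
  rewrite (_ : (fun y => _) = (fun y => (i <= level y)%N && ~~ (i < level y)%N)).
    by apply: measurable_and; [|apply: measurable_neg]; exact: measurable_level_ge.
  by apply/funext => y; rewrite -leqNgt andbC -eqn_leq.
have moppe : measurable_fun setT (-%E : \bar R -> \bar R) by exact: oppe_measurable.
case: c => c1 c2; rewrite (_ : (fun y => _) =
    (fun y => (level y == c1) && (level (- y)%E == c2))); last by apply/funext.
by apply: measurable_and => //; exact: (measurableT_comp (measurable_level_eq c2) moppe).
Qed.

Lemma measurable_fun_cell (F : cells -> R) :
  measurable_fun setT (fun y => F (cell y)).
Proof.
under eq_fun => y do rewrite -(sumr_indicator (cell y) F).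
apply: measurable_sum => c; apply: measurable_funM => //.
rewrite (_ : (fun y => _) = (fun y => if cell y == c then 1 else 0)).
  by apply: measurable_fun_ifT => //; exact: measurable_cell_eq.
by apply/funext => y; rewrite eq_sym; case: eqP.
Qed.

Lemma integral_oppe (f : \bar R -> R) : (forall y, 0 <= f y) -> measurable_fun setT f ->
  (\int[nu]_y (f (- y)%E)%:E = \int[nu]_y (f y)%:E)%E.
Proof.
move=> f0 mf; have [_ nu_oppe _ _ _] := BMS.
have moppe : measurable_fun setT (-%E : \bar R -> \bar R) by exact: oppe_measurable.
have := @ge0_integral_pushforward _ _ _ _ R _ moppe nu setT (EFin \o f) measurableT.
rewrite preimage_setT => <-.
- pose phi : {mfun (\bar R) >-> (\bar R)} := HB.pack (-%E : \bar R -> \bar R)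
    (isMeasurableFun.Build _ _ _ _ _ moppe).
  apply: (@eq_measure_integral _ _ R setT nu (pushforward nu phi) (EFin \o f)) => A mA _.
  exact: nu_oppe.
- exact/measurable_EFinP.
- by move=> y _; rewrite lee_fin.
Qed.

Lemma chan_dens_bpsk b y : chan_dens w (bpsk R b) y = if b then w (- y)%E else w y.
Proof.
have bpsk_eq1 : (bpsk R b == 1) = ~~ b.
  by have <- : bpsk R false = 1 := expr0 _; rewrite (inj_eq (@bpsk_inj R)); case: b.
by rewrite /chan_dens bpsk_eq1 if_neg.
Qed.

Lemma integrable_chan_dens b : nu.-integrable setT (fun y => (chan_dens w (bpsk R b) y)%:E).
Proof.
have [_ _ _ _ w1] := BMS.
have mf := measurable_chan_dens BMS (bpsk R b).
apply/integrableP; split; first exact/measurable_EFinP.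
rewrite (_ : (\int[nu]_x _)%E = 1%E) ?ltry // -w1.
under eq_integral do rewrite chan_dens_bpsk /=.
case: b {mf} => /=; last by apply: eq_integral => y _; rewrite ger0_norm.
by rewrite -(integral_oppe w_ge0 mw); apply: eq_integral => y _; rewrite ger0_norm.
Qed.

Definition cell_mass (c : cells) : R :=
  fine (\int[nu]_y ((cell y == c)%:R * w y)%:E)%E.

Lemma integrable_cell_mul (F : cells -> R) b :
  nu.-integrable setT (fun y => (F (cell y) * chan_dens w (bpsk R b) y)%:E).
Proof.
have F_bounded : [bounded F (cell y) | y in setT].
  exists (\sum_c `|F c|); split; first exact: num_real.
  move=> M /ltW FM y _ /=; apply: le_trans FM.
  by rewrite (bigD1 (cell y)) //= lerDl sumr_ge0.
have := integrableMr measurableT (measurable_fun_cell F) F_bounded (integrable_chan_dens b).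
by apply: eq_integrable => // y _; rewrite /= EFinM.
Qed.

Lemma integral_cell_eq c b :
  (\int[nu]_y ((cell y == c)%:R * chan_dens w (bpsk R b) y)%:E =
   (cell_mass (if b then swap c else c))%:E)%E.
Proof.
have massE c' : (\int[nu]_y ((cell y == c')%:R * w y)%:E = (cell_mass c')%:E)%E.
  rewrite fineK //; apply: integrable_fin_num => //.
  have := integrable_cell_mul (fun c => (c == c')%:R) false.
  by apply: eq_integrable => // y _; rewrite chan_dens_bpsk.
under eq_integral do rewrite chan_dens_bpsk; case: b; rewrite -massE //.
rewrite -[RHS]integral_oppe => [|y|].
- by apply: eq_integral => y _; rewrite cell_oppe (inj_eq (inv_inj swapK)).
- by rewrite mulr_ge0.
- by apply: measurable_funM => //; exact: (measurable_fun_cell (fun c' => (c' == swap c)%:R)).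
Qed.

Lemma integral_cell_mul (F : cells -> R) b :
  (\int[nu]_y (F (cell y) * chan_dens w (bpsk R b) y)%:E =
   (\sum_c cell_mass (if b then swap c else c) * F c)%:E)%E.
Proof.
under eq_integral => y _.
  rewrite -(sumr_indicator (cell y) F) mulr_suml -sumEFin.
  under eq_bigr => c _ do rewrite [_ * F c]mulrC -mulrA eq_sym EFinM.
  over.
rewrite /= integral_sum // => [|c]; last first.
  by apply: integrableZl => //; exact: (integrable_cell_mul (fun c' => (c' == c)%:R)).
rewrite -sumEFin; apply: eq_bigr => c _; rewrite integralZl //.
  by rewrite integral_cell_eq mulrC EFinM muleC.
exact: (integrable_cell_mul (fun c' => (c' == c)%:R)).
Qed.

Lemma cell_mass_ge0 c : 0 <= cell_mass c.
Proof.
by apply/fine_ge0/integral_ge0 => y _; rewrite lee_fin mulr_ge0.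
Qed.

Lemma sum_cell_mass : \sum_c cell_mass c = 1.
Proof.
have [_ _ _ _ w1] := BMS; apply: EFin_inj; rewrite -w1.
have := integral_cell_mul (fun=> 1) false; under [in RHS]eq_bigr do rewrite mulr1.
by move=> <-; apply: eq_integral => y _; rewrite mul1r chan_dens_bpsk.
Qed.

Lemma sum_swap (F : cells -> R) : \sum_c F (swap c) = \sum_c F c.
Proof. by rewrite [RHS](reindex_inj (inv_inj swapK)). Qed.

Definition cell_info (c : cells) : R :=
  (ln (1 + cell_bias c) + 1 / K) / (2 * ln 2).

Lemma info_density_le y : info_density w y <=
  cell_info (cell y) * w y + cell_info (swap (cell y)) * w (- y)%E.
Proof.
rewrite info_densityE /cell_info ![_ * w _]mulrC !mulrA -mulrDl.
rewrite ler_pM2r ?invr_gt0 ?mulr_gt0 ?ln2_gt0 //.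
apply: le_trans (binary_divergence_le_chi2 (w_ge0 y) (w_ge0 _) (cell_bias_itv (cell y))) _.
rewrite -/(bias y) cell_bias_swap; set r := cell_bias _.
have iK : 0 < 1 / K by rewrite divr_gt0.
have close : (bias y - r) ^+ 2 <= (1 / K) ^+ 2.
  rewrite -[leLHS]real_normK ?num_real // lerXn2r ?nnegrE ?(ltW iK) //.
  exact: cell_bias_close.
have r_far : 1 / K <= 1 - r ^+ 2.
  have r_bound := cell_bias_bound (cell y); rewrite -/r in r_bound.
  have r_lt1 : `|r| < 1 by rewrite -subr_gt0; exact: lt_le_trans r_bound.
  apply: le_trans r_bound _; rewrite lerD2l lerN2 -real_normK ?num_real // expr2.
  by rewrite ler_piMr // ltW.
have chi2_le : (bias y - r) ^+ 2 / (1 - r ^+ 2) <= 1 / K.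
  rewrite ler_pdivrMr ?(lt_le_trans iK) //; apply: le_trans close _.
  by rewrite expr2 ler_wpM2l // ltW.
have := ler_wpM2l (addr_ge0 (w_ge0 y) (w_ge0 (- y)%E)) chi2_le.
move: (1 / K) => d; lra.
Qed.

Lemma capacity_le_quantized :
  (capacity nu w <= ((\sum_c cell_mass c * ln (1 + cell_bias c) + 1 / K) / ln 2)%:E)%E.
Proof.
have <- : (\int[nu]_y ((cell_info (cell y) * chan_dens w (bpsk R false) y)%:E +
     (cell_info (swap (cell y)) * chan_dens w (bpsk R true) y)%:E))%E =
    ((\sum_c cell_mass c * ln (1 + cell_bias c) + 1 / K) / ln 2)%:E.
  rewrite integralD //; last 2 first.
  - exact: integrable_cell_mul.
  - exact: (integrable_cell_mul (fun c => cell_info (swap c))).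
  rewrite (integral_cell_mul cell_info) (integral_cell_mul (fun c => cell_info (swap c))) /=.
  rewrite (sum_swap (fun c => cell_mass c * cell_info c)) -EFinD; congr EFin.
  have -> : 1 / K = \sum_c cell_mass c * (1 / K) by rewrite -mulr_suml sum_cell_mass !mul1r.
  rewrite -!big_split mulr_suml /=; apply: eq_bigr => c _; rewrite /cell_info.
  by field; rewrite !lt0r_neq0 ?ln2_gt0.
apply: lower_integral_mono => y.
  by rewrite lee_fin -/(info_density w y) info_density_ge0.
by rewrite -EFinD lee_fin -/(info_density w y) !chan_dens_bpsk; exact: info_density_le.
Qed.

Section Softening.
Variable eps : R.
Hypothesis eps_gt0 : 0 < eps.
Hypothesis eps_lt1 : eps < 1.

(* Mixing the cell with a uniform one makes all cells possible. *)
Definition soft_mass (m : R) : R := (1 - eps) * m + eps / #|{: cells}|%:R.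

Definition soft_kernel (c : cells) (y : \bar R) : R :=
  soft_mass (c == cell y)%:R.

Let card_gt0 : 0 < #|{: cells}|%:R :> R.
Proof. by rewrite card_prod card_ord ltr0n. Qed.

Lemma soft_mass_gt0 m : 0 <= m -> 0 < soft_mass m.
Proof. by move=> m0; rewrite ltr_wpDl ?divr_gt0 // mulr_ge0 // subr_ge0 ltW. Qed.

Lemma sum_soft_mass (m : cells -> R) :
  \sum_c m c = 1 -> \sum_c soft_mass (m c) = 1.
Proof.
move=> m1; rewrite big_split /= -mulr_sumr m1 sumr_const -[_ *+ #|_|]mulr_natr divfK.
  by ring.
exact: lt0r_neq0.
Qed.

Definition soft_channel : symmetric_channel R :=
  {| output := cells; mirror := swap; erasure := (ord0, ord0);
     law := fun c => soft_mass (cell_mass c);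
     mirrorK := swapK; mirror_erasure := erefl;
     law_gt0 := fun c => soft_mass_gt0 (cell_mass_ge0 c);
     law_sum1 := sum_soft_mass sum_cell_mass |}.

Lemma soft_kernel_degradation :
  degradation nu w soft_kernel (@channel_law R soft_channel).
Proof.
split; first split=> [c y|y|c].
- by rewrite ltW // soft_mass_gt0.
- by apply: sum_soft_mass; under eq_bigr do rewrite -[_%:R]mulr1; rewrite sumr_indicator.
- exact: (measurable_fun_cell (fun c' => soft_mass (c == c')%:R)).
move=> c b; rewrite (integral_cell_mul (fun c' => soft_mass (c == c')%:R)); congr EFin.
rewrite /channel_law /= /soft_mass.
under eq_bigr do rewrite mulrDr mulrCA [cell_mass _ * _%:R]mulrC eq_sym.
rewrite big_split /= -mulr_sumr.
rewrite (sumr_indicator c (fun c' => cell_mass (if b then swap c' else c'))).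
rewrite -mulr_suml; congr (_ * _ + _).
by case: b; rewrite /= ?(sum_swap cell_mass) sum_cell_mass mul1r.
Qed.

End Softening.
End Quantization.

Lemma mixture_div0_ge (R : realType) (W : symmetric_channel R) (r : W -> R) :
  (forall z, -1 < r z < 1) -> (forall z, r (mirror z) = - r z) ->
  \sum_(z : W) law z * ln (1 + r z) <= mixture_div W 0.
Proof.
move=> r_itv r_mirror; rewrite -subr_ge0 -opprD oppr_ge0 -big_split /=.
have rp z : 0 < 1 + r z by have /andP[r1 _] := r_itv z; lra.
apply: (@le_trans _ _ (\sum_(z : W) law z * (mixture_lr z 0 * (1 + r z) - 1))).
  apply: ler_sum => z _; rewrite -mulrDr ler_wpM2l ?(ltW (law_gt0 z)) //.
  have m0 : 0 < mixture_lr z 0 by rewrite mixture_lr_gt0 ?normr0.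
  by rewrite -lnM ?posrE //; exact: ln_le_subr1 (mulr_gt0 m0 (rp z)).
have lawE (z : W) : law z * (mixture_lr z 0 * (1 + r z) - 1) =
    (law z * (1 + r z) + law (mirror z) * (1 - r (mirror z))) / 2 - law z.
  by have [_ ->] := law_symmetric W; rewrite r_mirror /mixture_lr; field.
rewrite (eq_bigr _ (fun z _ => lawE z)) sumrB -mulr_suml big_split /=.
rewrite (sum_mirror (fun z => law z * (1 - r z))) -big_split /=.
under eq_bigr do rewrite -mulrDr addrACA subrr addr0.
by rewrite -mulr_suml law_sum1; lra.
Qed.

Lemma convex_combination_gt (R : realType) (x y a : R) : a < x ->
  exists eps, [/\ 0 < eps, eps < 1 & a < (1 - eps) * x + eps * y].
Proof.
move=> ax; pose D := (x - a) + `|x - y| + 1; have n0 := normr_ge0 (x - y).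
have D0 : 0 < D by rewrite /D; lra.
exists ((x - a) / D); split.
- by rewrite divr_gt0 // subr_gt0.
- by rewrite ltr_pdivrMr // mul1r /D; lra.
have : (x - a) / D * (x - y) < x - a.
  rewrite mulrAC ltr_pdivrMr // ltr_pM2l ?subr_gt0 //.
  by have := ler_norm (x - y); rewrite /D; lra.
lra.
Qed.

Lemma exists_degradation (R : realType) (nu : {measure set (\bar R) -> \bar R})
    (w : \bar R -> R) (r0 : R) :
  is_BMS nu w -> (r0%:E < capacity nu w)%E ->
  exists (W : symmetric_channel R) (k : W -> \bar R -> R),
    degradation nu w k (@channel_law R W) /\ r0 * ln 2 < mixture_div W 0.
Proof.
move=> BMS r0_lt.
have [c capE] : exists c, capacity nu w = c%:E.
  exists (fine (capacity nu w)); rewrite fineK // fin_numElt (lt_trans (ltNyr _) r0_lt).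
  exact: le_lt_trans (capacity_le_quantized BMS 0) (ltry _).
rewrite capE lte_fin in r0_lt.
pose gap := (c - r0) * ln 2.
have gap0 : 0 < gap by rewrite mulr_gt0 ?subr_gt0 ?ln2_gt0.
pose n := Num.truncn gap^-1.
have n_large : 1 / n.+1%:R < gap.
  by rewrite div1r -[ltRHS]invrK ltf_pV2 ?posrE ?invr_gt0 // truncnS_gt.
have := capacity_le_quantized BMS n; rewrite capE lee_fin ler_pdivlMr ?ln2_gt0 //.
set info := \sum_c _ => c_le.
have r0_info : r0 * ln 2 < info.
  by rewrite -(ltrD2r (1 / n.+1%:R)); apply: lt_le_trans c_le; rewrite -ltrBrDl -mulrBl.
pose uniform_info : R :=
  (\sum_(c : 'I_n.+1 * 'I_n.+1) ln (1 + cell_bias R c)) / #|{: 'I_n.+1 * 'I_n.+1}|%:R.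
have [eps [eps_gt0 eps_lt1 mixed]] := convex_combination_gt uniform_info r0_info.
exists (soft_channel BMS n eps_gt0 eps_lt1), (soft_kernel w eps); split.
  exact: soft_kernel_degradation.
apply: lt_le_trans mixed _.
apply: le_trans (@mixture_div0_ge _ (soft_channel BMS n eps_gt0 eps_lt1) (@cell_bias R n) _ _).
- rewrite [leRHS](_ : _ = (1 - eps) * info + eps * uniform_info) //.
  under eq_bigr do rewrite /= /soft_mass mulrDl -!mulrA.
  by rewrite big_split /= -!mulr_sumr [_^-1 * _]mulrC.
- exact: cell_bias_itv.
- exact: cell_bias_swap.
Qed.

(** * Convergence of the bit error probability *)

Lemma RM_bit_err_le (R : realType) (nu : {measure set (\bar R) -> \bar R}) (w : \bar R -> R)
    (r0 : R) :
  is_BMS nu w -> 0 <= r0 -> (r0%:E < capacity nu w)%E ->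
  exists2 B : R, 0 < B & forall r m (i : 'I_(2 ^ m)), rate R r m < r0 ->
    (bit_err nu w (RM r m) i <= (B * ('C(m, r)%:R / (2 ^ m)%:R))%:E)%E.
Proof.
move=> BMS r0_ge0 /(exists_degradation BMS)[W [k [kW]]]; set cap := mixture_div W 0 => r0_lt.
have cap0 : 0 < cap by apply: le_lt_trans r0_lt; rewrite mulr_ge0 // ltW // ln2_gt0.
pose gap := cap - r0 * ln 2; have gap0 : 0 < gap by rewrite subr_gt0.
pose theta : R := gap / 4; pose eta : R := gap / (4 * cap).
have theta0 : 0 < theta by rewrite divr_gt0.
have eta0 : 0 < eta by rewrite divr_gt0 // mulr_gt0.
have eta1 : eta < 1.
  rewrite ltr_pdivrMr ?mulr_gt0 // mul1r /gap.
  by have := mulr_ge0 r0_ge0 (ltW (ln2_gt0 R)); lra.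
have r0_le : r0 * ln 2 <= (1 - eta) * (cap - theta).
  have eta_cap : eta * cap = gap / 4 by rewrite /eta; field; rewrite lt0r_neq0.
  by have := mulr_gt0 eta0 theta0; rewrite /theta /gap in eta_cap *; lra.
have sep0 : 0 < separation W * (eta * theta) by rewrite mulr_gt0 ?separation_gt0 // mulr_gt0.
exists (ln 2 / (separation W * (eta * theta))) => [|r m i rate_lt].
  by rewrite divr_gt0 // ln2_gt0.
have C_linear : zmod_closed (RM r m) by rewrite RM_RMlt; exact: RMlt_linear.
apply: le_trans (bit_err_le_extrinsic_mean BMS kW i C_linear) _; rewrite lee_fin.
have rate_ln2_lt : rate R r m * ln 2 < (1 - eta) * (cap - theta).
  by apply: lt_le_trans r0_le; rewrite ltr_pM2r ?ln2_gt0.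
have mean_ge := RM_extrinsic_mean i eta0 eta1 theta0 rate_ln2_lt.
by rewrite mulrAC ler_pdivlMr //; lra.
Qed.

Local Open Scope classical_set_scope.

Lemma bin_density_cvg0 (R : realType) (r m : nat -> nat) :
  (forall n, m n < m n.+1)%N -> (forall n, r n <= m n)%N ->
  (fun n => 'C(m n, r n)%:R / (2 ^ m n)%:R : R) @ \oo --> (0 : R).
Proof.
move=> m_incr rm; apply/cvgrPdist_lt => d d0; have [M small] := bin_density_lt d0.
have m_large n : (n <= m n)%N by elim: n => // n IHn; exact: leq_ltn_trans IHn (m_incr n).
exists M => // n /= Mn; rewrite sub0r normrN ger0_norm ?divr_ge0 //.
exact/small/rm/(leq_trans Mn).
Qed.

Theorem theorem1 (R : realType) (mu : {measure set (\bar R) -> \bar R})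
  (w : \bar R -> R) :
  is_BMS mu w ->
  (0 < capacity mu w < 1)%E ->
  forall (r m : nat -> nat) (Rlim : R),
    (forall n, r n <= m n)%N ->
    (forall n, 2 ^ m n < 2 ^ m n.+1)%N ->
    (fun n => rate R (r n) (m n)) @ \oo --> Rlim ->
    0 <= Rlim -> (Rlim%:E < capacity mu w)%E ->
    (fun n => \big[Order.max/0%E]_(i < 2 ^ m n)
                 bit_err mu w (RM (r n) (m n)) i) @ \oo --> 0%E.
Proof.
move=> BMS /andP[cap0 cap1] r m Rlim rm m_incr rate_cvg Rlim0 Rlim_lt.
have cap_fin : capacity mu w \is a fin_num.
  by rewrite ge0_fin_numE ?(ltW cap0) // (lt_trans cap1) // ltry.
rewrite -(fineK cap_fin) lte_fin in Rlim_lt; have [Rlim_mid mid_cap] := midf_lt Rlim_lt.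
set r0 := _ / 2 in Rlim_mid mid_cap.
have r0_cap : (r0%:E < capacity mu w)%E by rewrite -(fineK cap_fin) lte_fin.
have [B B0 err_le] := RM_bit_err_le BMS (le_trans Rlim0 (ltW Rlim_mid)) r0_cap.
pose bound n : R := B * ('C(m n, r n)%:R / (2 ^ m n)%:R).
have bound_cvg : bound @ \oo --> (0 : R).
  rewrite -(mulr0 B); apply: cvgMr; apply: bin_density_cvg0 => // n.
  by have := m_incr n; rewrite ltn_exp2l.
apply: (@squeeze_cvge _ _ _ _ (fun=> 0%E) _ (EFin \o bound)).
- near=> n; rewrite bigmax_ge_id /=; apply: bigmax_le => [|i _].
    by rewrite lee_fin mulr_ge0 ?(ltW B0) // divr_ge0.
  by apply: err_le; near: n; exact: (cvgr_lt _ rate_cvg).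
- exact: cvg_cst.
- by apply/fine_cvgP; split; [exact: nearW | exact: bound_cvg].
Unshelve. all: by end_near.
Qed.
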